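(* Let $(L/K,v)$ be a simple algebraic extension of valued fields which is pure, and suppose that $e:=e(L/K,v)=\epsilon(L/K,v)$. If $d(L/K,v)=1$, then there exist a generator $\eta$ of $L/K$ and $a_1,\ldots,a_e\in K\setminus\{0\}$ such that $\eta^\ell/a_\ell\in\mathcal{O}_L$ for $1\le\ell\le e$ and $$\mathcal{O}_L=\mathcal{O}_K\left[\frac{\eta^\ell}{a_\ell}\ \middle|\ 1\le\ell\le e\right]_v.$$
   Context: Valuations are written additively, with $v(0)=\infty$; a valuation of $K[x]$ may take the value $\infty$ on nonzero polynomials. A valued field extension $(L/K,v)$ is a field extension $L/K$ with a valuation $v$ of $L$ (also denoting its restriction to $K$). $\mathcal{O}_L,\mathcal{O}_K$ are the valuation rings, $\mathfrak{m}_L$ the maximal ideal of $\mathcal{O}_L$, $vL,vK$ the value groups and $Lv,Kv$ the residue fields. The extension is simple algebraic if $L=K(\eta)$ for some $\eta$ algebraic over $K$; such an $\eta$ is called a generator. $e(L/K,v)=(vL:vK)$ is the ramification index. The defect is $d(L/K,v)=\dfrac{[L^h:K^h]}{(vL:vK)\cdot[Lv:Kv]}$, where $L^h$ and $K^h$ are the henselizations determined by a fixed extension of $v$ to an algebraic closure $\overline K$. For a subring $A$ of $\mathcal{O}_L$, $A_v$ denotes the localization of $A$ at the prime ideal $A\cap\mathfrak{m}_L$. For a (totally) ordered abelian group $\Gamma$ and a subgroup $\Delta$, the initial index is $\epsilon(\Gamma|\Delta)=|\{\gamma\in\Gamma\mid 0\le\gamma<\Delta_{>0}\}|$, where $\Delta_{>0}$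 is the set of positive elements of $\Delta$ and $\gamma<\Delta_{>0}$ means $\gamma<\delta$ for all $\delta\in\Delta_{>0}$. Put $\epsilon(L/K,v)=\epsilon(vL|vK)$. Let $\eta$ be a generator of $L/K$; the valuation $\nu$ of $K[x]$ defined by $v$ and $\eta$ is $\nu(f)=v(f(\eta))$. Fix an extension $\overline\nu$ of $\nu$ to $\overline K[x]$, and for $f\in K[x]\setminus K$ put $\epsilon(f)=\max\{\overline\nu(x-a)\mid a\in\overline K\text{ a root of }f\}$ (this is independent of the choice of $\overline\nu$). A monic polynomial $Q\in K[x]\setminus K$ is a key polynomial for $\nu$ if $\deg(f)<\deg(Q)$ implies $\epsilon(f)<\epsilon(Q)$ for all $f\in K[x]\setminus K$. Let $n=[L:K]$, and let $\Psi_m$ be the set of key polynomials for $\nu$ of degree $m$. $(L/K,v)$ is pure in $\eta$ if $\Psi_m=\emptyset$ for every $m$ with $1<m<n$; it is pure if it is pure in some generator $\eta$ of $L/K$. *)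

(* Defs.v *)
From HB Require Import structures.
From mathcomp Require Import all_boot all_order all_algebra all_field.
From mathcomp Require Import ring_quotient generic_quotient.
From mathcomp Require Import finmap boolp classical_sets functions cardinality.
Set Implicit Arguments.
Unset Strict Implicit.
Unset Printing Implicit Defensive.
Import Order.TTheory GRing.Theory.
Local Open Scope classical_set_scope.
Local Open Scope quotient_scope.
Local Open Scope ring_scope.

(* Totally ordered abelian groups, written additively. *)
HB.mixin Record isOrderedAbelianGroup G of Num.POrderedZmodule G := {
  oag_le_total : total (fun x y : G => x <= y);
  oag_lerD2l : forall z x y : G, x <= y -> z + x <= z + y
}.

#[short(type="oagType")]
HB.structure Definition OrderedAbelianGroup :=
  { G of Num.POrderedZmodule G & isOrderedAbelianGroup G }.

(* [option G] is G with a largest element [None] (the value oo) adjoined. *)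
Section WithInfinity.
Variable G : oagType.
Implicit Types g h : option G.

Definition vle g h : bool :=
  match g, h with
  | _, None => true
  | None, Some _ => false
  | Some x, Some y => x <= y
  end.

Definition vlt g h : bool := ~~ vle h g.

Definition vadd g h : option G :=
  match g, h with
  | Some x, Some y => Some (x + y)
  | _, _ => None
  end.

Definition vmin g h : option G := if vle g h then g else h.

Lemma vle_trans : transitive vle.
Proof. by move=> [y|] [x|] [z|] //=; apply: le_trans. Qed.

Lemma vle_total : total vle.
Proof. by move=> [x|] [y|] //=; apply: oag_le_total. Qed.

Lemma vle_anti : antisymmetric vle.
Proof. by move=> [x|] [y|] //= /le_anti ->. Qed.

End WithInfinity.

(* The value oo may be taken on nonzero elements; this is impossible if R is
   a field (see [val_infty]). *)
Record valuation (G : oagType) (R : comNzRingType) := Valuation {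
  val_fun :> R -> option G;
  val0 : val_fun 0 = None;
  val1 : val_fun 1 = Some 0;
  valM : forall x y, val_fun (x * y) = vadd (val_fun x) (val_fun y);
  valD : forall x y, vle (vmin (val_fun x) (val_fun y)) (val_fun (x + y))
}.

Section ValuedField.
Variables (G : oagType) (L : fieldType) (v : valuation G L).

Lemma val_infty x : (v x == None) = (x == 0).
Proof.
have [->|x0] := eqVneq x 0; first by rewrite val0.
have := valM v x x^-1; rewrite mulfV // val1.
by case: (v x).
Qed.

Definition valring : {pred L} := fun x => vle (Some 0) (v x).

Definition maxideal : {pred L} := fun x => vlt (Some 0) (v x).

Lemma valN1 : v (-1) = Some 0.
Proof.
have := valM v (-1) (-1); rewrite mulrNN mulr1 val1.
case: (v (-1)) => //= g [gg]; congr Some.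
have := oag_le_total 0 g; case/orP => g0; apply: le_anti; rewrite g0 ?andbT /=.
  by have := oag_lerD2l g 0 g g0; rewrite -gg addr0.
by have := oag_lerD2l g g 0 g0; rewrite -gg addr0.
Qed.

Lemma valN x : v (- x) = v x.
Proof. by rewrite -mulN1r valM valN1; case: (v x) => //= g; rewrite add0r. Qed.

Lemma vle_valB g x y : vle g (v x) -> vle g (v y) -> vle g (v (x - y)).
Proof.
move=> gx gy; have := valD v x (- y); apply: vle_trans.
by rewrite /vmin valN; case: ifP.
Qed.

Lemma valring_subring : subring_closed valring.
Proof.
split=> [|x y|x y]; rewrite !unfold_in.
- by rewrite val1 /=.
- exact: vle_valB.
- rewrite valM; case: (v x) => [g|]; case: (v y) => [h|] //= g0 h0.
  by apply: le_trans g0 _; rewrite -[leLHS]addr0; apply: oag_lerD2l.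
Qed.

HB.instance Definition _ := GRing.isSubringClosed.Build L valring valring_subring.

(* The valuation ring O_L, as a type. *)
Record valringT := ValRing { valring_val : L; valring_valP : valring_val \in valring }.

HB.instance Definition _ := [isSub for valring_val].
HB.instance Definition _ := [Choice of valringT by <:].
HB.instance Definition _ := [SubChoice_isSubComNzRing of valringT by <:].

(* The maximal ideal m_L, as an ideal of the type O_L. *)
Definition maxidealT : {pred valringT} := fun x => \val x \in maxideal.

Lemma maxidealT_idealr : idealr_closed maxidealT.
Proof.
have E (x : valringT) : (x \in maxidealT) = vlt (Some 0) (v (\val x)) by [].
split=> [||a x y]; rewrite ?E ?rmorph0 ?rmorph1 ?val0 ?val1 //.
  by rewrite /vlt /= lexx.
rewrite rmorphD rmorphM /= => x0 y0; have a0 := valring_valP a.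
suff ax0 : vlt (Some 0) (v (\val a * \val x)).
  have := valD v (\val a * \val x) (\val y); rewrite /vlt; apply: contraL => h.
  apply/negP => h'; have := vle_trans h' h.
  by rewrite /vmin; case: ifP => _; apply/negP.
move: a0 x0; rewrite unfold_in valM.
case: (v (valring_val a)) => [g|]; case: (v (valring_val x)) => [h|] //= g0.
rewrite /vlt /=; apply: contra; apply: le_trans.
by have := oag_lerD2l h 0 g g0; rewrite addr0 addrC.
Qed.

HB.instance Definition _ := isIdealr.Build valringT maxidealT maxidealT_idealr.

(* The residue field Lv = O_L / m_L (here with its ring structure). *)
Definition residue := {ideal_quot maxidealT}.

HB.instance Definition _ := GRing.ComNzRing.on residue.

(* For a subring A of O_L, the localization of A at A `&` m_L, inside L. *)
Definition localize (A : set L) : set L :=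
  [set x | exists a b, [/\ A a, A b, b \notin maxideal & x = a / b]].

End ValuedField.

(* Cardinality of a finite set; 0 if the set is infinite. *)
Definition ncard (T : choiceType) (A : set T) : nat := #|` fset_set A|.

(* A[S], the smallest subring containing A and S. *)
Definition adjoin (R : nzRingType) (A S : set R) : set R :=
  smallest [set B : set R | subring_closed [in B]] (A `|` S).

(* The degree [E : F] of subfields F `<=` E of a ring R; 0 if infinite. *)
Definition is_basis (R : comNzRingType) (F E : set R) n (b : 'I_n -> R) :=
  (forall i, E (b i)) /\
  forall x, E x -> exists! c : {ffun 'I_n -> R},
    (forall i, F (c i)) /\ x = \sum_(i < n) c i * b i.

Definition degree (R : comNzRingType) (F E : set R) : nat :=
  xget 0%N [set n | exists b : 'I_n -> R, is_basis F E b].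

Section OrderedGroups.
Variable G : oagType.

(* (Gamma : Delta), as the number of cosets of Delta in Gamma. *)
Definition group_index (Gamma Delta : set G) : nat :=
  ncard [set [set g + d | d in Delta] | g in Gamma].

Definition initial_index (Gamma Delta : set G) : nat :=
  ncard [set g | [/\ Gamma g, 0 <= g & forall d, Delta d -> 0 < d -> g < d]].

End OrderedGroups.

(* A finite extension L of K, with a valuation v of L; the valuation of K is
   the restriction of v along [in_alg L : K -> L]. *)
Section ValuedExtension.
Variables (G : oagType) (K : fieldType) (L : fieldExtType K).
Variable v : valuation G L.

Definition value_group : set G := [set g | exists x : L, v x = Some g].

Definition base_value_group : set G :=
  [set g | exists c : K, v c%:A = Some g].

Definition ramification_index : nat :=
  group_index value_group base_value_group.

Definition ext_initial_index : nat :=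
  initial_index value_group base_value_group.

(* O_K and Kv, as subsets of L and Lv respectively. *)
Definition base_valring : set L := [set c%:A | c in [set c : K | c%:A \in valring v]].

Definition base_residue : set (residue v) :=
  [set \pi_(residue v) x | x in [set x : valringT v | base_valring (\val x)]].

Definition residue_degree : nat := degree base_residue [set: residue v].

Definition is_generator (eta : L) : Prop := (<<1; eta>> = fullv)%VS.

End ValuedExtension.

(* C plays the role of an algebraic closure, with valuation vbar. *)
Section Henselization.
Variables (G : oagType) (C : closedFieldType) (vbar : valuation G C).

(* The henselization of F in C determined by vbar is the decomposition field:
   the elements of C which are separable over F and are fixed by every
   F-automorphism s of C with vbar \o s = vbar. *)
Definition separable_over (F : fieldType) (j : {rmorphism F -> C}) (x : C) :=
  exists2 p : {poly F}, separable_poly p & root (map_poly j p) x.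

Definition henselization (F : fieldType) (j : {rmorphism F -> C}) : set C :=
  [set x | separable_over j x /\
     forall s : {rmorphism C -> C}, bijective s ->
       (forall c, s (j c) = j c) -> (forall y, vbar (s y) = vbar y) -> s x = x].

End Henselization.

Section Pure.
Variables (G : oagType) (K : fieldType) (L : fieldExtType K).
Variables (C : closedFieldType) (iota : {rmorphism L -> C}).

Definition base_embed : {rmorphism K -> C} := iota \o in_alg L.

(* C, with L embedded by iota, is an algebraic closure of K. *)
Definition is_alg_closure : Prop := forall x : C, algebraicOver base_embed x.

Definition defect (v : valuation G L) (vbar : valuation G C) : rat :=
  (degree (henselization vbar base_embed) (henselization vbar iota))%:R
  / (ramification_index v * residue_degree v)%:R.

(* nubar extends to C[x] the valuation nu(f) = v(f(eta)) of K[x]. *)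
Definition extends_nu (v : valuation G L) (eta : L)
    (nubar : valuation G {poly C}) : Prop :=
  forall f : {poly K},
    nubar (map_poly base_embed f) = v (map_poly (in_alg L) f).[eta].

Section Eps.
Variable nubar : valuation G {poly C}.

(* Maximum of nubar (x - a) over the roots a of f in C. *)
Definition eps (f : {poly K}) : option G :=
  xget None [set g |
    (exists2 a, root (map_poly base_embed f) a & nubar ('X - a%:P) = g) /\
    (forall a, root (map_poly base_embed f) a -> vle (nubar ('X - a%:P)) g)].

Definition key_polynomial (Q : {poly K}) : Prop :=
  [/\ Q \is monic, (1 < size Q)%N &
    forall f : {poly K}, (1 < size f)%N -> (size f < size Q)%N ->
      vlt (eps f) (eps Q)].

End Eps.

(* The auxiliary extension nubar of nu may be chosen arbitrarily. *)
Definition pure_in (v : valuation G L) (eta : L) : Prop :=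
  exists2 nubar, extends_nu v eta nubar &
    forall m, (1 < m < \dim {:L})%N ->
      ~ exists2 Q, key_polynomial nubar Q & (size Q).-1 = m.

Definition pure (v : valuation G L) : Prop :=
  exists2 eta, is_generator eta & pure_in v eta.

End Pure.

(* Main.v *)
(* Fix a generator eta in which L/K is pure. By minimality of degree, the absence of key
   polynomials of degree strictly between 1 and n means that every root of a polynomial of
   degree < n is dominated: it is at most as close to eta as some c in K.

   If v(eta - c) attains its maximum at c0 (and eta is not in K), put x = eta - c0. By the
   Gauss lemma every f(eta) with deg f < n is a sum of terms c_i x^i of value at least
   v(f(eta)). As e = epsilon, each coset of vK contains an element between 0 and the
   positive elements of vK, so x^l can be divided by some a_l in K in such a way that
   c x^l in O_L forces c a_l in O_K; powers beyond some k <= e reduce to smaller ones because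
   v(x^k) lies in vK for such a k.

   Otherwise L/K is immediate, so d = 1 gives [L^h : K^h] = 1 and eta lies in K^h. A conjugate
   of eta that is as close to eta as all of K would be the image of eta under an isometric
   K-automorphism of the algebraic closure, hence equal to eta. So there is c in K closer to
   eta than all other conjugates, and after rescaling theta = (eta - c)/d is a root of a
   polynomial H over O_K congruent to X + const modulo the maximal ideal. Writing
   (theta - c2) B = H(theta) - H(c2) = - H(c2) shows that every element of O_L, expanded around
   a sufficiently good approximation of eta, is a polynomial in 1/B over O_K.

   Isometric automorphisms come from Zorn's lemma; the one-step extension compares the norm
   of a suitable element computed from the two sides of the embedding. *)
Require Import Defs.
From HB Require Import structures.
From mathcomp Require Import all_boot all_order all_algebra all_field ring.
From mathcomp Require Import ring_quotient generic_quotient finmap.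
From mathcomp Require Import boolp classical_sets functions cardinality.
Import Order.TTheory GRing.Theory.
Local Open Scope classical_set_scope.
Local Open Scope quotient_scope.
Local Open Scope ring_scope.
Set Implicit Arguments.
Unset Strict Implicit.
Unset Printing Implicit Defensive.

(** * Values and valuations *)

Section OrderWithInfinity.
Variable G : oagType.
Implicit Types a b c d : option G.

Lemma oag_ltNge (x y : G) : (x < y) = ~~ (y <= x).
Proof.
rewrite lt_neqAle; have [yx|nyx] := boolP (y <= x).
  by have [->|] := eqVneq x y; rewrite // andTb; apply: contra_neqF => xy; apply/le_anti/andP.
have := oag_le_total x y; rewrite (negPf nyx) orbF => -> ; rewrite andbT.
by apply: contraNneq nyx => ->.
Qed.

Lemma oag_leD2l (z x y : G) : (z + x <= z + y) = (x <= y).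
Proof.
apply/idP/idP => [|/(oag_lerD2l z)//].
by move=> /(oag_lerD2l (- z)); rewrite !addKr.
Qed.

Lemma oag_ltD2l (z x y : G) : (z + x < z + y) = (x < y).
Proof. by rewrite !oag_ltNge oag_leD2l. Qed.

Lemma vle_refl a : vle a a.
Proof. by case: a => /=. Qed.

Lemma vltW a b : vlt a b -> vle a b.
Proof. by rewrite /vlt; have := vle_total a b; case: (vle b a); rewrite ?orbF. Qed.

Lemma vlexx_lt a : vlt a a = false.
Proof. by rewrite /vlt vle_refl. Qed.

Lemma vlt_le_trans b a c : vlt a b -> vle b c -> vlt a c.
Proof. by rewrite /vlt => nba bc; apply: contra nba; exact: vle_trans. Qed.

Lemma vle_lt_trans b a c : vle a b -> vlt b c -> vlt a c.
Proof. by rewrite /vlt => ab; apply: contra => ca; exact: vle_trans ab. Qed.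

Lemma vlt_trans b a c : vlt a b -> vlt b c -> vlt a c.
Proof. by move=> /vltW; exact: vle_lt_trans. Qed.

Lemma vleNone a : vle a None.
Proof. by case: a. Qed.

Lemma vltNone a : vlt a None = (a != None).
Proof. by case: a. Qed.

Lemma vlt_fin a b : vlt a b -> a != None.
Proof. by case: a => //=; case: b. Qed.

Lemma vle_fin a b : vle a b -> b != None -> a != None.
Proof. by case: a b => [?|] [?|]. Qed.

Lemma vltSome (x y : G) : vlt (Some x) (Some y) = (x < y).
Proof. by rewrite /vlt /= oag_ltNge. Qed.

Lemma vle_eqVlt a b : vle a b -> a = b \/ vlt a b.
Proof.
move=> ab; have [ba|nba] := boolP (vle b a); last by right.
by left; apply: vle_anti; rewrite ab.
Qed.

Lemma vneq_lt a b : a <> b -> vlt a b \/ vlt b a.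
Proof.
have [ab nE|nab nE] := boolP (vle a b); last by right.
by left; case: (vle_eqVlt ab).
Qed.

Lemma vaddC : commutative (@vadd G).
Proof. by case=> [x|] [y|] //=; rewrite addrC. Qed.

Lemma vaddA : associative (@vadd G).
Proof. by case=> [x|] [y|] [z|] //=; rewrite addrA. Qed.

Lemma vadd0 : left_id (Some 0) (@vadd G).
Proof. by case=> [x|] //=; rewrite add0r. Qed.

HB.instance Definition _ := Monoid.isComLaw.Build (option G) (Some 0) (@vadd G)
  vaddA vaddC vadd0.

Lemma vadd_fin a b : (vadd a b != None) = (a != None) && (b != None).
Proof. by case: a; case: b. Qed.

Lemma vleD a b c d : vle a b -> vle c d -> vle (vadd a c) (vadd b d).
Proof.
case: a b c d => [a|] [b|] [c|] [d|] //= ab cd.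
apply: (@le_trans _ _ (a + d)); first by rewrite oag_leD2l.
by rewrite ![_ + d]addrC oag_leD2l.
Qed.

Lemma vltD2r a b c : c != None -> vlt a b -> vlt (vadd a c) (vadd b c).
Proof.
case: a b c => [a|] [b|] [c|] //= _; rewrite !vltSome.
by rewrite ![_ + c]addrC oag_ltD2l.
Qed.

Lemma vlt_leD a b c d :
  c != None -> vlt a b -> vle c d -> vlt (vadd a c) (vadd b d).
Proof.
move=> cf ab cd; apply: vlt_le_trans (vltD2r cf ab) _.
by apply: vleD => //; exact: vle_refl.
Qed.

Lemma vle_ltD a b c d :
  a != None -> vle a b -> vlt c d -> vlt (vadd a c) (vadd b d).
Proof. by move=> af ab cd; rewrite [vadd a c]vaddC [vadd b d]vaddC vlt_leD. Qed.

Lemma vltD2rE a b c : vlt (vadd a c) (vadd b c) -> vlt a b.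
Proof. by apply: contra => ba; apply: vleD => //; exact: vle_refl. Qed.

Lemma vleD2rE a b c : c != None -> vle (vadd a c) (vadd b c) -> vle a b.
Proof. by move=> cf; apply: contraTT => /(vltD2r cf). Qed.

Lemma vaddI a b c : c != None -> vadd a c = vadd b c -> a = b.
Proof.
case: c a b => // c [a|] [b|] //= _ [] /eqP; rewrite ![_ + c]addrC.
by rewrite (inj_eq (addrI c)) => /eqP ->.
Qed.

End OrderWithInfinity.

Section ValuationTheory.
Variables (G : oagType) (R : comNzRingType) (w : valuation G R).
Implicit Types (x y : R) (g : option G).

Lemma rvalN x : w (- x) = w x.
Proof.
suff w1 : w (-1) = Some 0 by rewrite -mulN1r Defs.valM w1 vadd0.
have := Defs.valM w (-1) (-1); rewrite mulrNN mulr1 Defs.val1.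
case: (w (-1)) => //= g [gg]; congr Some; apply: le_anti.
have := oag_leD2l g 0 g; rewrite -gg addr0 => E.
by case/orP: (oag_le_total 0 g) => /= g0; rewrite E ?g0 // -E g0.
Qed.

Lemma rvalBC x y : w (x - y) = w (y - x).
Proof. by rewrite -opprB rvalN. Qed.

Lemma val_geD g x y : vle g (w x) -> vle g (w y) -> vle g (w (x + y)).
Proof. by move=> gx gy; apply: vle_trans (valD w x y); rewrite /vmin; case: ifP. Qed.

Lemma val_gtD g x y : vlt g (w x) -> vlt g (w y) -> vlt g (w (x + y)).
Proof. by move=> gx gy; apply: vlt_le_trans (valD w x y); rewrite /vmin; case: ifP. Qed.

Lemma val_geB g x y : vle g (w x) -> vle g (w y) -> vle g (w (x - y)).
Proof. by move=> gx gy; apply: val_geD; rewrite ?rvalN. Qed.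

Lemma val_gtB g x y : vlt g (w x) -> vlt g (w y) -> vlt g (w (x - y)).
Proof. by move=> gx gy; apply: val_gtD; rewrite ?rvalN. Qed.

Lemma val_addl x y : vlt (w x) (w y) -> w (x + y) = w x.
Proof.
move=> xy; apply: vle_anti; apply/andP; split; last first.
  by apply: val_geD; [exact: vle_refl|exact: vltW].
apply: contraT => lt1; have := val_gtB (lt1 : vlt (w x) (w (x + y))) xy.
by rewrite addrK vlexx_lt.
Qed.

Lemma val_ge_sum (I : Type) (r : seq I) (P : pred I) (F : I -> R) g :
  (forall i, P i -> vle g (w (F i))) -> vle g (w (\sum_(i <- r | P i) F i)).
Proof.
move=> gF; elim/big_ind: _ => //; first by rewrite val0 vleNone.
by move=> x y; exact: val_geD.
Qed.

Lemma val_gt_sum (I : Type) (r : seq I) (P : pred I) (F : I -> R) g :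
  g != None ->
  (forall i, P i -> vlt g (w (F i))) -> vlt g (w (\sum_(i <- r | P i) F i)).
Proof.
move=> g0 gF; elim/big_ind: _ => //; first by rewrite val0 vltNone.
by move=> x y; exact: val_gtD.
Qed.

Lemma val_prod (I : Type) (r : seq I) (F : I -> R) :
  w (\prod_(i <- r) F i) = \big[@vadd G/Some 0]_(i <- r) w (F i).
Proof. by apply: (big_morph w (Defs.valM w) (Defs.val1 w)). Qed.

Lemma val_nat_ge0 n : vle (Some 0) (w n%:R).
Proof.
elim: n => [|n IH]; first by rewrite val0.
by rewrite mulrS; apply: val_geD => //; rewrite Defs.val1 vle_refl.
Qed.

Lemma val_ge0M x y :
  vle (Some 0) (w x) -> vle (Some 0) (w y) -> vle (Some 0) (w (x * y)).
Proof. by rewrite Defs.valM => x0 y0; rewrite -[Some 0]vadd0; exact: vleD. Qed.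

Lemma val_gt0M x y :
  vlt (Some 0) (w x) -> vle (Some 0) (w y) -> vlt (Some 0) (w (x * y)).
Proof. by rewrite Defs.valM => x0 y0; rewrite -[Some 0]vadd0; exact: vlt_leD. Qed.

Lemma val_ge0X x n : vle (Some 0) (w x) -> vle (Some 0) (w (x ^+ n)).
Proof.
move=> x0; elim: n => [|n IH]; first by rewrite Defs.val1 vle_refl.
by rewrite exprS; exact: val_ge0M.
Qed.

Lemma val_unitX x n : w x = Some 0 -> w (x ^+ n) = Some 0.
Proof.
move=> x0; elim: n => [|n IH]; first by rewrite Defs.val1.
by rewrite exprS Defs.valM x0 IH vadd0.
Qed.

End ValuationTheory.

(** * Separation of valuations with a common support *)

Section Separation.
Variables (G : oagType) (R : comNzRingType).
Implicit Types (w u : valuation G R) (x y z : R).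

(** Integers have value at least 0 under every valuation, so one polynomial over the integers can be
    tested against several valuations of R at once. *)
Definition eval_int (F : {poly int}) z : R := (map_poly intr F).[z].

Lemma eval_intE F z : eval_int F z = \sum_(i < size F) (F`_i)%:~R * z ^+ i.
Proof.
rewrite /eval_int (@horner_coef_wide _ (size F)) ?size_poly //.
by apply: eq_bigr => i _; rewrite coef_map.
Qed.

Lemma val_int_ge0 w (m : int) : vle (Some 0) (w m%:~R).
Proof. by case: m => n; rewrite ?NegzE ?mulrNz ?rvalN; exact: val_nat_ge0. Qed.

Lemma eval_int_ge0 w F z : vle (Some 0) (w z) -> vle (Some 0) (w (eval_int F z)).
Proof.
move=> z0; rewrite eval_intE; apply: val_ge_sum => i _.
by apply: val_ge0M; [exact: val_int_ge0|exact: val_ge0X].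
Qed.

Lemma val_lt0X w z n : vlt (w z) (Some 0) -> vlt (w (z ^+ n.+1)) (Some 0).
Proof.
move=> z0; elim: n => [//|n IH]; rewrite exprS Defs.valM -[Some 0]vadd0.
by apply: vlt_leD => //; [exact: vlt_fin IH|exact: vltW].
Qed.

Lemma val_lt0X_mono w z i k :
  vlt (w z) (Some 0) -> (i < k)%N -> vlt (w (z ^+ k)) (w (z ^+ i)).
Proof.
move=> z0 ik; rewrite -(subnK ik) addnS -addSn exprD Defs.valM.
rewrite -[X in vlt _ X]vadd0; apply: vltD2r; last exact: val_lt0X.
by case: i {ik} => [|i]; [rewrite Defs.val1|exact: vlt_fin (val_lt0X _ z0)].
Qed.

(** At an element of negative value the leading term, with coefficient 1, has the strictly smallest
    value. *)
Lemma eval_int_lt0 w F z : F \is monic -> (1 < size F)%N ->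
  vlt (w z) (Some 0) -> vlt (w (eval_int F z)) (Some 0).
Proof.
move=> /monicP mF F1 z0; rewrite eval_intE.
case sF: (size F) F1 => [|[|n]] // _; rewrite big_ord_recr /= addrC.
have -> : F`_n.+1 = 1 by rewrite -mF /lead_coef sF.
rewrite mul1r val_addl; first exact: val_lt0X.
apply: val_gt_sum => [|i _]; first exact: vlt_fin (val_lt0X _ z0).
rewrite Defs.valM; apply: (@vlt_le_trans _ (w (z ^+ i))).
  exact: val_lt0X_mono.
rewrite -[X in vle X _]vadd0; apply: vleD; [exact: val_int_ge0|exact: vle_refl].
Qed.

(* F = 1 + X * prod F_i, where F_i has positive value at z under w_i if some admissible
   polynomial does; if none does, then F, being admissible, does not either. *)
Lemma exists_denominator (I : finType) (w : I -> valuation G R) z :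
  exists F : {poly int}, [/\ F \is monic, (1 < size F)%N, F`_0 = 1
    & forall i, vle (w i (eval_int F z)) (Some 0)].
Proof.
pose adm (F : {poly int}) := [/\ F \is monic, (1 < size F)%N & F`_0 = 1].
pose kills i F := adm F /\ vlt (Some 0) (w i (eval_int F z)).
have /choice[f fP] : forall i, exists F,
    F \is monic /\ ((exists F', kills i F') -> kills i F).
  move=> i; have [[F kF]|nF] := pselect (exists F', kills i F').
    by exists F; split=> //; case: kF => -[].
  by exists 1; split; rewrite ?monic1.
pose P := \prod_i f i.
have mP : P \is monic by apply: monic_prod => i _; case: (fP i).
have sXP : (size (1 : {poly int})%R < size ('X * P)%R)%N.
  by rewrite size_poly1 mulrC size_mulX ?monic_neq0 // ltnS size_poly_gt0 monic_neq0.
have aF : adm ('X * P + 1).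
  split; first by rewrite monicE lead_coefDl // -monicE monicMl ?monicX.
    by rewrite size_polyDl // (leq_ltn_trans _ sXP) // size_poly1.
  by rewrite coefD coefXM coef1 /= add0r.
exists ('X * P + 1); case: (aF) => mF sF F0; split=> // i.
suff : ~~ vlt (Some 0) (w i (eval_int ('X * P + 1) z)) by rewrite /vlt negbK.
apply/negP => pos; have [_ /(_ (ex_intro _ _ (conj aF pos)))[_ fpos]] := fP i.
have [z0|z0] := boolP (vle (Some 0) (w i z)); last first.
  by have := vlt_trans pos (eval_int_lt0 mF sF z0); rewrite vlexx_lt.
have E : eval_int ('X * P + 1) z = 1 + eval_int (f i) z *
     (z * eval_int (\prod_(j | j != i) f j) z).
  rewrite /eval_int rmorphD rmorphM rmorph1 /= map_polyX hornerD hornerM hornerX.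
  by rewrite hornerC addrC /P (bigD1 i) //= rmorphM hornerM mulrCA.
suff h : w i (eval_int ('X * P + 1) z) = Some 0 by rewrite h vlexx_lt in pos.
rewrite E val_addl ?Defs.val1 //; apply: val_gt0M => //.
by apply: val_ge0M => //; exact: eval_int_ge0.
Qed.

Lemma eval_int_near1 u (F : {poly int}) z : F`_0 = 1 -> vlt (Some 0) (u z) ->
  vlt (Some 0) (u (eval_int F z - 1)).
Proof.
move=> F0 z0; have -> : eval_int F z - 1 =
    z * \sum_(i < (size F).-1) (F`_i.+1)%:~R * z ^+ i.
  rewrite eval_intE; case sF: (size F) => [|n].
    by move: F0; rewrite nth_default ?sF // => /eqP; rewrite eq_sym oner_eq0.
  rewrite big_ord_recl /= F0 mulr1 addrAC subrr add0r mulr_sumr.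
  by apply: eq_bigr => i _; rewrite exprS mulrCA.
apply: val_gt0M => //; apply: val_ge_sum => i _.
by apply: val_ge0M; [exact: val_int_ge0|apply: val_ge0X; exact: vltW].
Qed.

Lemma near1_val u x : vlt (Some 0) (u (x - 1)) -> u x = Some 0.
Proof. by move=> x1; rewrite -[x](subrK 1) addrC val_addl Defs.val1. Qed.

Lemma near1M u x y : vlt (Some 0) (u (x - 1)) -> vlt (Some 0) (u (y - 1)) ->
  vlt (Some 0) (u (x * y - 1)).
Proof.
move=> x1 y1; have -> : x * y - 1 = (y - 1) * x + (x - 1) by ring.
by apply: val_gtD => //; apply: val_gt0M => //; rewrite (near1_val x1) vle_refl.
Qed.

Section CommonSupport.
Variables (I : finType) (u : valuation G R) (w : I -> valuation G R).
(** Modulo the support of u the ring R is a field, and u and all w_i are valuations of this field,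
    written on R. *)
Hypothesis w_supp : forall i x, u x = None -> w i x = None.
Hypothesis u_inv : forall x, u x != None -> exists y, u (x * y - 1) = None.

(* x = 1 - prod 1/F_i(q_i), where q_i is positive at u and negative at w_i. *)
Lemma separating_element (D : set I) :
  (forall i, D i -> exists q, vlt (Some 0) (u q) /\ vlt (w i q) (Some 0)) ->
  exists x, vlt (Some 0) (u x) /\ forall i, D i -> w i x = Some 0.
Proof.
move=> sepD.
have /choice[p pP] : forall i, exists p, [/\ vlt (Some 0) (u (p - 1)),
    forall j, vle (Some 0) (w j p) & D i -> vlt (Some 0) (w i p)].
  move=> i; have [/sepD[q [uq wq]]|nDi] := pselect (D i); last first.
    by exists 1; rewrite subrr val0 vltNone; split=> // j; rewrite Defs.val1 vle_refl.
  have [F [mF sF F0 wF]] := exists_denominator w q.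
  have uF := eval_int_near1 F0 uq; have uF0 := near1_val uF.
  (* The element p inverts F(q) modulo the support. As F(q) has value at most 0 under every w_j, p
     is integral everywhere; as F(q) is negative at w_i, p is positive there. *)
  have /u_inv[p Fp1] : u (eval_int F q) != None by rewrite uF0.
  have wFp j : vadd (w j (eval_int F q)) (w j p) = Some 0.
    by rewrite -Defs.valM; apply: near1_val; rewrite w_supp.
  have Ffin j : w j (eval_int F q) != None.
    by move: (wFp j); case: (w j (eval_int F q)).
  exists p; split=> [|j|_].
  - have up : u p = Some 0.
      have : u (eval_int F q * p) = Some 0 by apply: near1_val; rewrite Fp1.
      by rewrite Defs.valM uF0 vadd0.
    have -> : p - 1 = (eval_int F q * p - 1) - (eval_int F q - 1) * p by ring.
    by apply: val_gtB; [rewrite Fp1|apply: val_gt0M => //; rewrite up vle_refl].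
  - apply: contraT => /(fun h => vltD2r (Ffin j) h).
    rewrite vadd0 [vadd (w j p) _]vaddC wFp => /(fun h => vlt_le_trans h (wF j)).
    by rewrite vlexx_lt.
  - apply: contraT; rewrite -/(is_true _) negbK => ple.
    have := vlt_leD _ (eval_int_lt0 mF sF wq) ple; rewrite wFp vadd0 vlexx_lt.
    by apply; move: (wFp i); case: (w i p) => //; case: (w i _).
have w_prod i : D i -> vlt (Some 0) (w i (\prod_j p j)).
  move=> Di; rewrite (bigD1 i) //=; apply: val_gt0M; first by case: (pP i) => _ _; apply.
  elim/big_ind: _ => [|a b|j _]; [by rewrite Defs.val1 vle_refl|exact: val_ge0M|].
  by case: (pP j).
exists (1 - \prod_j p j); split=> [|i Di]; last first.
  by rewrite val_addl ?Defs.val1 // rvalN; exact: w_prod.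
rewrite rvalBC; elim/big_ind: _ => [|a b|j _]; [by rewrite subrr val0|exact: near1M|].
by case: (pP j).
Qed.

End CommonSupport.

Lemma first_min (f : nat -> option G) n : (0 < n)%N -> exists i,
  [/\ (i < n)%N, forall j, (j < n)%N -> vle (f i) (f j) & forall j, (j < i)%N -> vlt (f i) (f j)].
Proof.
elim: n => // -[|n] IH _.
  by exists 0%N; split=> // -[|j] // _; exact: vle_refl.
have [i [ilt imin ifst]] := IH isT.
have [le_i|lt_i] := boolP (vle (f i) (f n.+1)).
  exists i; split=> // [|j]; first exact: ltnW.
  by rewrite ltnS leq_eqVlt => /orP[/eqP->|/imin].
exists n.+1; split=> // [j|j jn]; last exact: vlt_le_trans (imin j jn).
rewrite ltnS leq_eqVlt => /orP[/eqP->|jn]; first exact: vle_refl.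
by apply: vltW; exact: vlt_le_trans (imin j jn).
Qed.

(* If sum_j c_j x^j = 0 and i is the first index where w(c_j x^j) is minimal, then
   p = sum_(j >= i) (c_j / c_i) x^(j - i) is close to 1 at u and positive at w. *)
Lemma separate_two (M : fieldType) (k : {rmorphism M -> R}) (u w : valuation G R) :
  (forall c, u (k c) = w (k c)) ->
  (forall x, u x = None -> w x = None) ->
  (forall x, u x != None -> exists y, u (x * y - 1) = None) ->
  (forall x, exists2 h : {poly M}, h != 0 & u (map_poly k h).[x] = None) ->
  (exists x, u x <> w x) ->
  exists q, vlt (Some 0) (u q) /\ vlt (w q) (Some 0).
Proof.
move=> uw_k w_supp u_inv u_alg [x0 x0P].
have inv x : u x != None -> exists y,
    vadd (u x) (u y) = Some 0 /\ vadd (w x) (w y) = Some 0.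
  move=> /u_inv[y xy1]; exists y; rewrite -!Defs.valM.
  by split; apply: near1_val; rewrite ?xy1 ?w_supp.
have k_fin c : c != 0 -> w (k c) != None.
  move=> c0; have := Defs.valM w (k c) (k c^-1).
  by rewrite -rmorphM mulfV // rmorph1 Defs.val1; case: (w (k c)).
(* If the inequality at x0 goes the other way, an inverse of x0 modulo the support reverses it. *)
have [x [uw wx]] : exists x, vlt (w x) (u x) /\ w x != None.
  have x0fin : u x0 != None.
    by apply/eqP => ux0; apply: x0P; rewrite ux0 w_supp.
  have wx0fin : w x0 != None by have [y [_]] := inv _ x0fin; case: (w x0).
  have [uw|wu] := vneq_lt x0P; last by exists x0.
  have [y [uy wy]] := inv _ x0fin.
  have wyf : w y != None by move: wy; case: (w y) => //; case: (w x0).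
  exists y; split=> //; apply: (@vltD2rE _ _ _ (u x0)).
  rewrite [vadd (u y) _]vaddC uy -wy vaddC [vadd (w x0) _]vaddC ![vadd (w y) _]vaddC.
  exact: vltD2r.
have wX n : w (x ^+ n) != None.
  elim: n => [|n IH]; first by rewrite expr0 Defs.val1.
  by rewrite exprS Defs.valM vadd_fin wx.
have uwX n : vlt (w (x ^+ n.+1)) (u (x ^+ n.+1)).
  elim: n => [//|n IH]; rewrite exprS [w _]Defs.valM [u _]Defs.valM.
  by apply: vlt_leD => //; exact: vltW.
have [h h0 hx] := u_alg x.
have hs : (0 < size h)%N by rewrite size_poly_gt0.
have [i [ilt imin ifst]] := @first_min (fun j => w (k h`_j * x ^+ j)) _ hs.
have ifin : w (k h`_i * x ^+ i) != None.
  have := imin (size h).-1; rewrite prednK // => /(_ (leqnn _)) /vle_fin; apply.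
  by rewrite Defs.valM vadd_fin wX andbT; apply: k_fin; rewrite lead_coef_eq0.
have hi0 : h`_i != 0 by apply: contra_neq ifin => ->; rewrite rmorph0 mul0r val0.
pose T j := k (h`_j / h`_i) * x ^+ (j - i).
have T_E j : (i <= j)%N -> (k h`_i * x ^+ i) * T j = k h`_j * x ^+ j.
  move=> ij; rewrite /T mulrACA -rmorphM -exprD subnKC //.
  by rewrite mulrCA mulfV // mulr1.
pose p := \sum_(j < size h | (i <= j)%N) T j.
have up : vlt (Some 0) (u (p - 1)).
  rewrite /p (bigD1 (Ordinal ilt)) //= {1}/T subnn mulr1 mulfV // rmorph1 addrAC subrr add0r.
  apply: val_gt_sum => // j /andP[ij jNi].
  have {jNi}ij : (i < j)%N by rewrite ltn_neqAle ij andbT eq_sym.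
  have [hj0|hj0] := eqVneq h`_j 0; first by rewrite /T hj0 mul0r rmorph0 mul0r val0.
  have Tge : vle (Some 0) (w (T j)).
    apply: (@vleD2rE _ _ _ _ ifin); rewrite vadd0 vaddC -Defs.valM T_E ?(ltnW ij) //.
    exact: imin.
  apply: vle_lt_trans Tge _; rewrite /T !Defs.valM uw_k -(subnSK ij).
  by apply: vle_ltD => //; [apply: k_fin; rewrite mulf_neq0 ?invr_eq0|exact: vle_refl].
have wp : vlt (Some 0) (w p).
  apply: (@vltD2rE _ _ _ (w (k h`_i * x ^+ i))); rewrite vadd0 vaddC -Defs.valM.
  (* As h(x) lies in the support, this product is minus the sum of the terms before i, whose values
     are larger by the choice of i. *)
  have -> : k h`_i * x ^+ i * p =
      (map_poly k h).[x] - \sum_(j < size h | ~~ (i <= j)%N) k h`_j * x ^+ j.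
    rewrite (@horner_coef_wide _ (size h)) ?size_poly //.
    rewrite (bigID (fun j : 'I__ => (i <= j)%N)) /= mulr_sumr -[LHS]addr0 -addrA.
    congr (_ + _).
      by apply: eq_bigr => j ij; rewrite T_E // coef_map.
    by apply/esym/eqP; rewrite subr_eq0; apply/eqP/eq_bigr => j _; rewrite coef_map.
  apply: val_gtB; first by rewrite (w_supp _ hx) vltNone.
  by apply: val_gt_sum => // j; rewrite -ltnNge; exact: ifst.
(* The required element is q - 1 with q inverse to p: q is close to 1 at u and negative at w. *)
have up0 := near1_val up.
have /u_inv[q pq] : u p != None by rewrite up0.
have uq : u q = Some 0.
  have : u (p * q) = Some 0 by apply: near1_val; rewrite pq.
  by rewrite Defs.valM up0 vadd0.
have wpq : vadd (w p) (w q) = Some 0.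
  by rewrite -Defs.valM; apply: near1_val; rewrite w_supp.
have wq : vlt (w q) (Some 0).
  apply: (@vltD2rE _ _ _ (w p)); rewrite vadd0 vaddC wpq //.
exists (q - 1); split; last by rewrite val_addl ?rvalN ?Defs.val1.
have -> : q - 1 = (p * q - 1) - (p - 1) * q by ring.
by apply: val_gtB; [rewrite pq|apply: val_gt0M => //; rewrite uq vle_refl].
Qed.

End Separation.

(** * Extension of isometric embeddings *)

(** Splitting f into linear factors reduces this to the determinant of A - b, which up to sign is
    the characteristic polynomial at b. *)
Lemma det_horner_mx (C : closedFieldType) n (A : 'M[C]_n.+1) (r : seq C) (f : {poly C}) :
  char_poly A = \prod_(x <- r) ('X - x%:P) -> \det (horner_mx A f) = \prod_(x <- r) f.[x].
Proof.
move=> Ar; have [s ->] := closed_field_poly_normal f.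
have sr : size r = n.+1.
  by apply: succn_inj; rewrite -(size_prod_XsubC r id) -Ar size_char_poly.
rewrite linearZ rmorph_prod /= detZ.
under [RHS]eq_bigr do rewrite hornerZ horner_prod.
rewrite big_split /= big_const_seq count_predT iter_mulr_1 sr; congr (_ * _).
rewrite exchange_big /= (big_morph _ (@det_mulmx _ _) (det1 _ _)).
apply: eq_bigr => b _; rewrite rmorphB /= horner_mx_X horner_mx_C.
under eq_bigr do rewrite hornerXsubC.
have -> : A - b%:M = -1 *: (b%:M - A) by rewrite scaleN1r opprB.
have -> : \det (-1 *: (b%:M - A)) = (-1) ^+ size r * (char_poly A).[b].
  rewrite detZ sr /char_poly -horner_evalE -det_map_mx; congr (_ * \det _).
  by apply/matrixP => i j; rewrite !mxE /= /horner_eval hornerD hornerN hornerMn hornerX hornerC.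
rewrite Ar horner_prod; elim: (r) => [|x t IH]; first by rewrite !big_nil mulr1.
by rewrite !big_cons -IH hornerXsubC /= exprS; ring.
Qed.

(** N is the norm of f modulo g, taken as the determinant of f at a companion matrix. It is defined
    over M, so every embedding of M computes it from the roots of its own image of g. *)
Lemma common_norm (M : fieldType) (g f : {poly M}) : g \is monic -> (1 < size g)%N ->
  exists N : M, forall (C : closedFieldType) (s : {rmorphism M -> C}) (r : seq C),
    map_poly s g = \prod_(x <- r) ('X - x%:P) ->
    s N = \prod_(x <- r) (map_poly s f).[x].
Proof.
move=> mg sg.
have [n [A gA]] : exists n (A : 'M[M]_n.+1), char_poly A = g.
  move: (companionmx g) (companionmxK mg); case: (size g) sg => [|[|n]] // _ A gA.
  by exists n, A.
exists (\det (horner_mx A f)) => C s r gr.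
by rewrite -det_map_mx map_horner_mx (det_horner_mx (r := r)) // -map_char_poly gA.
Qed.

Section ExtendIsometry.
Variables (G : oagType) (C : closedFieldType) (vb : valuation G C).
Variable M : fieldType.

(** The valuation of C restricted to s(M)[y] and pulled back to M[X]; different roots and embeddings
    thus give valuations of one common ring. *)
Definition eval_val (s : {rmorphism M -> C}) (y : C) (f : {poly M}) := vb (map_poly s f).[y].

Program Definition evalV s y := @Valuation G {poly M} (eval_val s y) _ _ _ _.
Next Obligation. by rewrite /eval_val rmorph0 horner0 val0. Qed.
Next Obligation. by rewrite /eval_val rmorph1 hornerC Defs.val1. Qed.
Next Obligation. by rewrite /eval_val rmorphM hornerM Defs.valM. Qed.
Next Obligation. by rewrite /eval_val rmorphD hornerD; exact: valD. Qed.

Lemma minimal_polynomial (s : {rmorphism M -> C}) (x : C) : algebraicOver s x ->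
  exists g : {poly M}, [/\ g \is monic, (1 < size g)%N,
    forall f, root (map_poly s f) x = (g %| f)
    & forall f, ~~ root (map_poly s f) x -> exists h, g %| f * h - 1].
Proof.
move=> [p p0 px]; pose P n := `[< exists q : {poly M}, [/\ q != 0, root (map_poly s q) x & size q = n] >].
have /ex_minnP[n /asboolP[q [q0 qx <-]] qmin] : exists n, P n.
  by exists (size p); apply/asboolP; exists p.
have lq0 : lead_coef q != 0 by rewrite lead_coef_eq0.
have gq : (lead_coef q)^-1 *: q %= q by apply: eqp_scale; rewrite invr_eq0.
exists ((lead_coef q)^-1 *: q); split.
- by rewrite monicE lead_coefZ mulVf.
- rewrite size_scale ?invr_eq0 // ltnNge; apply/negP => /size1_polyC E.
  by move: qx q0; rewrite E map_polyC /= rootC fmorph_eq0 polyC_eq0 => /eqP ->; rewrite eqxx.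
- move=> f; rewrite (eqp_dvdl _ gq); apply/idP/idP => [fx|/dvdpP[k ->]]; last first.
    by rewrite rmorphM rootM qx orbT.
  have P_gcd : P (size (gcdp q f)).
    by apply/asboolP; exists (gcdp q f); rewrite gcdp_eq0 negb_and q0 gcdp_map root_gcd qx.
  have : gcdp q f %= q.
    by rewrite -dvdp_size_eqp ?dvdp_gcdl // eqn_leq qmin // dvdp_leq // dvdp_gcdl.
  by move=> /eqp_dvdl <-; exact: dvdp_gcdr.
(* The gcd does not vanish at x, so its cofactor in q does, and minimality of the degree of q makes
   the gcd constant. *)
move=> f fx; have : coprimep q f.
  have gx : ~~ root (map_poly s (gcdp q f)) x.
    by rewrite gcdp_map root_gcd qx.
  have /dvdpP[k qk] := dvdp_gcdl q f; have k0 : k != 0.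
    by apply: contra_neq q0 => k0; rewrite qk k0 mul0r.
  have kx : root (map_poly s k) x.
    by move: qx; rewrite qk rmorphM rootM (negPf gx) orbF.
  have : P (size k) by apply/asboolP; exists k.
  have g0 : gcdp q f != 0 by rewrite gcdp_eq0 negb_and q0.
  move=> /qmin; rewrite {1}qk size_mul // /coprimep => le.
  have : (0 < size (gcdp q f))%N by rewrite size_poly_gt0.
  by case: (size (gcdp q f)) le => [|[|m]] // + _; rewrite addnS /= -[X in (_ <= X)%N]addn0 leq_add2l.
move=> /Bezout_eq1_coprimepP[[a b] /= ab1]; exists b.
by rewrite (eqp_dvdl _ gq) -ab1 opprD [f * b]mulrC addrCA subrr addr0 dvdpNr dvdp_mull.
Qed.

(** If no y works, the valuation u at x differs from those at all roots over [s2]. Take z positive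
    at u and of value 0 at every root whose valuation is not u. Its norm has value 0 computed over
    [s2] and positive value over [s1], although the two embeddings are isometric. *)
Lemma extend_isometry (s1 s2 : {rmorphism M -> C}) (x : C) :
  (forall c, vb (s1 c) = vb (s2 c)) -> (forall y, algebraicOver s1 y) ->
  exists y, forall f : {poly M}, vb (map_poly s1 f).[x] = vb (map_poly s2 f).[y].
Proof.
move=> s12 alg; apply: contrapT => none.
have [g [mg sg g_root g_inv]] := minimal_polynomial (alg x).
have split_g (s : {rmorphism M -> C}) :
    {r : seq C | map_poly s g = \prod_(y <- r) ('X - y%:P)}.
  have [r rE] := closed_field_poly_normal (map_poly s g); exists r.
  by rewrite {1}rE lead_coef_map (monicP mg) rmorph1 scale1r.
have [[r1 gr1] [r2 gr2]] := (split_g s1, split_g s2).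
have gx : root (map_poly s1 g) x by rewrite g_root.
pose u := evalV s1 x.
pose w (i : 'I_(size r1) + 'I_(size r2)) :=
  match i with inl i => evalV s1 r1`_i | inr i => evalV s2 r2`_i end.
have w_root i f : g %| f -> w i f = None.
  move=> /dvdpP[k ->]; case: i => i; rewrite /= /eval_val rmorphM /= hornerM.
    by rewrite gr1 horner_prod (big_nth 0) big_mkord (bigD1 i) //= hornerXsubC subrr mul0r mulr0 val0.
  by rewrite gr2 horner_prod (big_nth 0) big_mkord (bigD1 i) //= hornerXsubC subrr mul0r mulr0 val0.
have u_root f : g %| f -> u f = None.
  by move=> /dvdpP[k ->]; rewrite /= /eval_val rmorphM /= hornerM (rootP gx) mulr0 val0.
have u_inv f : u f != None -> exists h, g %| f * h - 1.
  by move=> uf; apply: g_inv; apply: contra uf => /rootP fx; rewrite /= /eval_val fx val0.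
have w_supp i f : u f = None -> w i f = None.
  move=> /eqP; rewrite [_ == _](val_infty vb) => fx; apply: w_root.
  by rewrite -g_root.
have u_inv' f : u f != None -> exists h, u (f * h - 1) = None.
  by move=> /u_inv[h /u_root uh]; exists h.
(* D collects the roots, on either side, whose valuation differs from u. *)
pose D : set _ := [set i | exists f, u f <> w i f].
have sep i : D i -> exists q, vlt (Some 0) (u q) /\ vlt (w i q) (Some 0).
  apply: (@separate_two _ _ M polyC u (w i)) => //.
  - by move=> c; case: i => i /=; rewrite /eval_val !map_polyC !hornerC /= ?s12.
  - by move=> f; exact: w_supp.
  move=> f; have [h h0 hf] := alg (map_poly s1 f).[x]; exists h => //.
  rewrite -/(comp_poly f h) /= /eval_val map_comp_poly horner_comp.
  by rewrite (rootP hf) val0.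
have [z [uz wz]] := separating_element w_supp u_inv' sep.
have [N NE] := common_norm z mg sg.
have := s12 N; rewrite (NE _ _ _ gr1) (NE _ _ _ gr2) !val_prod.
have -> : \big[@vadd G/Some 0]_(y <- r2) vb (map_poly s2 z).[y] = Some 0.
  rewrite (big_nth 0) big_mkord big1 // => i _.
  apply: (wz (inr i)); apply: contrapT => nD; apply: none; exists r2`_i => f.
  by apply: contrapT => neq; apply: nD; exists f.
suff : vlt (Some 0) (\big[@vadd G/Some 0]_(y <- r1) vb (map_poly s1 z).[y]).
  by move=> /[swap] ->; rewrite vlexx_lt.
have xr1 : x \in r1 by move: gx; rewrite gr1 root_prod_XsubC.
rewrite (big_nth 0) big_mkord.
have xi : (index x r1 < size r1)%N by rewrite index_mem.
rewrite (bigD1 (Ordinal xi)) //= nth_index // -[X in vlt X _]vadd0.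
apply: vlt_leD; [by []|exact: uz|].
elim/big_ind: _ => [|a b a0 b0|i _]; first exact: vle_refl.
  by rewrite -[Some 0]vadd0; exact: vleD.
(* The remaining roots over [s1] contribute 0, or the positive value of z at u if their valuation
   equals u. *)
have [Di|nDi] := pselect (D (inl i)); first by rewrite -[vb _]/(w (inl i) z) wz // vle_refl.
have -> : vb (map_poly s1 z).[r1`_i] = u z.
  by apply: contrapT => neq; apply: nDi; exists z => /esym.
exact: vltW.
Qed.

End ExtendIsometry.

(** * Isometric automorphisms of the algebraic closure *)

Section IsometryGraph.
Variables (G : oagType) (C : closedFieldType) (vb : valuation G C).

(* Graphs of isometric ring homomorphisms between subrings of C; such a set is functional
   since vb only takes the value oo at 0. *)
Definition isometry_graph (g : set (C * C)) :=
  [/\ g 1, forall p q, g p -> g q -> g (p - q), forall p q, g p -> g q -> g (p * q)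
    & forall p, g p -> vb p.1 = vb p.2].

Lemma isometry_graph_eq0 g p : isometry_graph g -> g p -> (p.1 == 0) = (p.2 == 0).
Proof. by case=> _ _ _ iso gp; rewrite -!(val_infty vb) iso. Qed.

Lemma isometry_graph_fun g p q : isometry_graph g -> g p -> g q -> p.1 = q.1 -> p.2 = q.2.
Proof.
move=> ig gp gq pq; have [_ gB _ _] := ig.
have /= := isometry_graph_eq0 ig (gB _ _ gp gq).
by rewrite pq subrr eqxx => /esym; rewrite subr_eq0 => /eqP.
Qed.

(** The extension of an isometry to fractions; it shows that the domain of a maximal isometry is a
    field. *)
Definition frac_graph (g : set (C * C)) : set (C * C) :=
  [set (p.1 / q.1, p.2 / q.2) | p in g & q in [set q | g q /\ q.1 != 0]].

Lemma frac_graph_isometry g : isometry_graph g -> isometry_graph (frac_graph g).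
Proof.
move=> ig; have [g1 gB gM iso] := ig.
have snd0 q : g q -> q.1 != 0 -> q.2 != 0 by move=> /(isometry_graph_eq0 ig) ->.
split.
- exists 1 => //; exists 1 => /=; first by rewrite oner_eq0.
  by rewrite divr1.
- move=> _ _ [p gp [q [gq q0] <-]] [p' gp' [q' [gq' q0'] <-]].
  have [q2 q2'] := (snd0 _ gq q0, snd0 _ gq' q0').
  exists (p * q' - p' * q); first by apply: gB; apply: gM.
  exists (q * q'); first by split; [exact: gM|rewrite mulf_neq0].
  by congr (_, _) => /=; field; apply/andP.
- move=> _ _ [p gp [q [gq q0] <-]] [p' gp' [q' [gq' q0'] <-]].
  exists (p * p'); first exact: gM.
  exists (q * q'); first by split; [exact: gM|rewrite mulf_neq0].
  by congr (_, _) => /=; rewrite mulf_div.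
- move=> _ [p gp [q [gq q0] <-]] /=; apply: (@vaddI _ _ _ (vb q.1)).
    by rewrite (val_infty vb).
  rewrite -Defs.valM divfK // (iso q gq) -Defs.valM divfK ?iso //.
  exact: snd0 gq q0.
Qed.

Lemma sub_frac_graph g : isometry_graph g -> g `<=` frac_graph g.
Proof.
move=> [g1 _ _ _] [x y] gp; exists (x, y) => //; exists 1; first by rewrite /= oner_eq0.
by rewrite /= !divr1.
Qed.

Definition inv_closed_graph (g : set (C * C)) :=
  forall p, g p -> g (p.1^-1, p.2^-1).

(** The pairs of such a graph form a field M, and the two projections embed M in C; this is the
    input that [extend_isometry] takes. *)
Record field_graph := FieldGraph {
  graph_set :> set (C * C);
  graph_isometry : isometry_graph graph_set;
  graph_inv : inv_closed_graph graph_set }.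

Section GraphField.
Variable g : field_graph.

Definition graph_pred : {pred C * C} := fun p => `[< graph_set g p >].

Lemma graph_subring : subring_closed graph_pred.
Proof.
have [g1 gB gM _] := graph_isometry g; split.
- exact/asboolP.
- by move=> p q /asboolP gp /asboolP gq; apply/asboolP; exact: gB.
- by move=> p q /asboolP gp /asboolP gq; apply/asboolP; exact: gM.
Qed.

HB.instance Definition _ := GRing.isSubringClosed.Build (C * C)%type graph_pred graph_subring.

Record graphT := GraphT { graph_val : C * C; graph_valP : graph_val \in graph_pred }.

HB.instance Definition _ := [isSub for graph_val].
HB.instance Definition _ := [Choice of graphT by <:].
HB.instance Definition _ := [SubChoice_isSubComNzRing of graphT by <:].

Lemma graph_inv_subproof (p : graphT) :
  ((\val p).1^-1, (\val p).2^-1) \in graph_pred.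
Proof. by apply/asboolP; apply: graph_inv; apply/asboolP; exact: graph_valP. Qed.

Definition graph_invr (p : graphT) := GraphT (graph_inv_subproof p).

Lemma graph_mulVr (p : graphT) : p != 0 -> graph_invr p * p = 1.
Proof.
move=> p0; have gp : graph_set g (\val p) by apply/asboolP; exact: graph_valP.
have p1 : (\val p).1 != 0.
  apply: contra_neq p0 => p1; apply: val_inj; apply/eqP.
  rewrite -pair_eqE /pair_eq /= p1 eqxx -(isometry_graph_eq0 (graph_isometry g) gp).
  by rewrite p1 eqxx.
apply: val_inj; rewrite rmorphM rmorph1 /=; congr (_, _) => /=; rewrite mulVf //.
by rewrite -(isometry_graph_eq0 (graph_isometry g) gp).
Qed.

Lemma graph_invr0 : graph_invr 0 = 0.
Proof. by apply: val_inj; rewrite /= !invr0. Qed.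

HB.instance Definition _ := GRing.ComNzRing_isField.Build graphT graph_mulVr graph_invr0.

Definition graph_fst : {rmorphism graphT -> C} := fst \o \val.
Definition graph_snd : {rmorphism graphT -> C} := snd \o \val.

End GraphField.

End IsometryGraph.

Lemma rmorphism_of (R S : comNzRingType) (f : R -> S) : f 1 = 1 ->
  (forall x y, f (x - y) = f x - f y) -> (forall x y, f (x * y) = f x * f y) ->
  exists s : {rmorphism R -> S}, s =1 f.
Proof.
move=> f1 fB fM.
pose fz := GRing.isZmodMorphism.Build R S f fB.
pose fm := GRing.isMonoidMorphism.Build R S f (conj f1 fM).
pose s : {rmorphism R -> S} := HB.pack f fz fm.
by exists s.
Qed.

Section Conjugation.
Variables (G : oagType) (C : closedFieldType) (vb : valuation G C).
Variables (K : fieldType) (j : {rmorphism K -> C}).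
Hypothesis alg_j : forall x, algebraicOver j x.

(** Being injective, s permutes the finite set of roots of each polynomial over K, so it is
    surjective. *)
Lemma algebraic_bijective (s : {rmorphism C -> C}) :
  (forall c, s (j c) = j c) -> bijective s.
Proof.
move=> sj.
have surj y : exists x, s x = y.
  have [p p0 py] := alg_j y.
  have [r rE] := closed_field_poly_normal (map_poly j p).
  have p0' : map_poly j p != 0 by rewrite map_poly_eq0.
  have mem x : (x \in undup r) = root (map_poly j p) x.
    by rewrite mem_undup rE rootZ ?lead_coef_eq0 // root_prod_XsubC.
  have sub : {subset map s (undup r) <= undup r}.
    move=> _ /mapP[x + ->]; rewrite !mem => /rootP px.
    have -> : map_poly j p = map_poly s (map_poly j p).
      by rewrite -map_poly_comp; apply: eq_map_poly => c /=; rewrite sj.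
    by apply/rootP; rewrite horner_map px rmorph0.
  have us : uniq (map s (undup r)) by rewrite map_inj_uniq ?undup_uniq //; exact: fmorph_inj.
  have [|_ eqr] := uniq_min_size us sub; first by rewrite size_map.
  by have := py; rewrite -mem -eqr => /mapP[x _ ->]; exists x.
have [t tP] := choice surj; exists t => // x; apply: (fmorph_inj s); exact: tP.
Qed.

Theorem isometry_extension (g0 : set (C * C)) : isometry_graph vb g0 ->
  (forall c, g0 (j c, j c)) ->
  exists s : {rmorphism C -> C}, [/\ bijective s, forall y, vb (s y) = vb y
    & forall p, g0 p -> s p.1 = p.2].
Proof.
move=> ig0 g0j.
(* Adjoining [g0] to X, instead of requiring X to contain it, makes the union of the empty chain
   admissible. *)
have [|A [iA maxA]] := @Zorn_bigcup (C * C)%type [set X | isometry_graph vb (X `|` g0)].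
  move=> F FP tot; rewrite /=; set U := _ `|` g0.
  have cover p q : U p -> U q -> exists Y, [/\ isometry_graph vb Y, Y p, Y q & Y `<=` U].
    have sub X : F X -> X `|` g0 `<=` U.
      by move=> FX x [Xx|]; [left; exists X|right].
    case=> [[X FX Xp]|g0p] [[Y FY Yq]|g0q].
    - case: (tot X Y FX FY) => [XY|YX].
        by exists (Y `|` g0); split; [exact: FP|left; exact: XY|left|exact: sub].
      by exists (X `|` g0); split; [exact: FP|left|left; exact: YX|exact: sub].
    - by exists (X `|` g0); split; [exact: FP|left|right|exact: sub].
    - by exists (Y `|` g0); split; [exact: FP|right|left|exact: sub].
    - by exists g0; split=> // x; right.
  split.
  - by right; case: ig0.
  - by move=> p q Up Uq; have [Y [[_ YB _ _] Yp Yq]] := cover _ _ Up Uq; apply; exact: YB.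
  - by move=> p q Up Uq; have [Y [[_ _ YM _] Yp Yq]] := cover _ _ Up Uq; apply; exact: YM.
  - by move=> p Up; have [Y [[_ _ _ iso] Yp _ _]] := cover _ _ Up Up; exact: iso.
pose g := A `|` g0; rewrite /= -/g in iA.
have g_max g' : isometry_graph vb g' -> g `<=` g' -> g' `<=` g.
  move=> ig' gg'; apply: contrapT => ng'; apply: (maxA g').
    split; first by move=> x Ax; apply: gg'; left.
    by move=> g'A; apply: ng' => x /g'A; left.
  by rewrite /= (_ : g' `|` g0 = g') // setUidl // => x g0x; apply: gg'; right.
(* The graph of fractions is an isometry graph containing g, so it is contained in g by
   maximality. *)
have g_inv : inv_closed_graph g.
  move=> p gp; have [p0|p0] := eqVneq p.1 0.
    have := isometry_graph_eq0 iA gp; rewrite p0 eqxx => /esym/eqP ->.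
    rewrite invr0; have [g1 gB _ _] := iA.
    by have := gB _ _ g1 g1; rewrite subrr.
  apply: (g_max _ (frac_graph_isometry iA) (sub_frac_graph iA)).
  exists 1; first by case: (iA).
  by exists p; rewrite // !div1r.
pose M := graphT (FieldGraph iA g_inv).
pose s1 : {rmorphism M -> C} := graph_fst _; pose s2 : {rmorphism M -> C} := graph_snd _.
have gM (m : M) : g (s1 m, s2 m).
  rewrite /s1 /s2 /= -surjective_pairing; apply/asboolP.
  exact: (graph_valP m).
have Mg p : g p -> exists m : M, (s1 m, s2 m) = p.
  move=> gp; have gp' : p \in graph_pred (FieldGraph iA g_inv) by apply/asboolP.
  by exists (GraphT gp'); rewrite /s1 /s2 /= -surjective_pairing.
have iso : forall p, g p -> vb p.1 = vb p.2 by case: (iA).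
have alg1 y : algebraicOver s1 y.
  have [p p0 py] := alg_j y.
  have /choice[k kE] : forall c, exists m : M, (s1 m, s2 m) = (j c, j c).
    by move=> c; apply: Mg; right.
  have k1 c : s1 (k c) = j c by have [] := kE c.
  have E : map_poly s1 (map_poly k p) = map_poly j p.
    have k0 : k 0 = 0 by apply: (fmorph_inj s1); rewrite k1 !rmorph0.
    apply/polyP => i; rewrite [LHS]coef_map [RHS]coef_map coef_map_id0; [exact: k1|exact: k0].
  exists (map_poly k p); last by rewrite E.
  by apply: contra_neq p0 => k0; apply/eqP; rewrite -(map_poly_eq0 j) -E k0 rmorph0.
(* The pairs (f(x), f(y)) form an isometry graph containing g, so maximality puts (x, y) into g. *)
have tot x : exists y, g (x, y).
  have [y yE] := extend_isometry (s2 := s2) x (fun m => iso _ (gM m)) alg1.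
  exists y; pose g' := [set ((map_poly s1 f).[x], (map_poly s2 f).[y]) | f in [set: {poly M}]].
  apply: (g_max g').
  - split.
    + by exists 1 => //; rewrite !rmorph1 !hornerC.
    + by move=> _ _ [f _ <-] [f' _ <-]; exists (f - f') => //; rewrite !rmorphB !hornerD !hornerN.
    + by move=> _ _ [f _ <-] [f' _ <-]; exists (f * f') => //; rewrite !rmorphM !hornerM.
    + by move=> _ [f _ <-] /=.
  - by move=> p /Mg[m <-]; exists m%:P => //; rewrite !map_polyC !hornerC.
  - by exists 'X => //; rewrite !map_polyX !hornerX.
have [f fP] := choice tot.
have fE p : g p -> f p.1 = p.2 by move=> gp; exact: (isometry_graph_fun iA (fP _) gp).
have [g1 gB gM' _] := iA.
have [|x y|x y|s sE] := @rmorphism_of C C f.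
- exact: (fE 1).
- exact: (fE _ (gB _ _ (fP x) (fP y))).
- exact: (fE _ (gM' _ _ (fP x) (fP y))).
have sg0 p : g0 p -> s p.1 = p.2 by move=> g0p; rewrite sE; apply: fE; right.
exists s; split=> //.
  by apply: algebraic_bijective => c; exact: (sg0 _ (g0j c)).
by move=> y; rewrite sE -(iso _ (fP y)).
Qed.

End Conjugation.

(** * The Gauss lemma and pure extensions *)

Section Gauss.
Variables (G : oagType) (R : comNzRingType) (w : valuation G R) (t : R).
Implicit Types (P : {poly R}) (e : R).

(** The value of P at t is the value of P under the Gauss valuation that gives X the value of t. *)
Definition gauss_le P := forall i, vle (w P.[t]) (w (P`_i * t ^+ i)).

Definition gauss_lt P := w P.[t] != None /\
  w P`_0 = w P.[t] /\ forall i, vlt (w P.[t]) (w (P`_i.+1 * t ^+ i.+1)).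

(** Each new monomial is a sum of an old one times t and an old one times e, and both t and e have
    value at least that of t + e. *)
Lemma gauss_leM P e : gauss_le P -> vle (w (t + e)) (w t) ->
  gauss_le (P * ('X + e%:P)).
Proof.
move=> gP et i; rewrite hornerM hornerD hornerX hornerC Defs.valM.
have we : vle (w (t + e)) (w e).
  have {2}-> : e = (t + e) - t by rewrite addrAC subrr add0r.
  by apply: val_geB; rewrite ?vle_refl.
rewrite mulrDr coefD coefMX coefMC mulrDl; apply: val_geD; last first.
  by rewrite mulrAC Defs.valM; exact: vleD.
case: i => [|i] /=; first by rewrite mul0r val0 vleNone.
by rewrite exprSr mulrA Defs.valM; exact: vleD.
Qed.

Lemma gauss_ltM P e : gauss_lt P -> vlt (w (t + e)) (w t) ->
  gauss_lt (P * ('X + e%:P)).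
Proof.
move=> [fin [P0 gP]] et.
have we : w e = w (t + e).
  have {1}-> : e = (t + e) - t by rewrite addrAC subrr add0r.
  by rewrite val_addl // rvalN.
have ePt : (P * ('X + e%:P)).[t] = P.[t] * (t + e) by rewrite hornerM hornerD hornerX hornerC.
rewrite /gauss_lt ePt Defs.valM; split; first by rewrite vadd_fin fin (vlt_fin et).
split.
  by rewrite mulrDr coefD coefMX add0r coefMC Defs.valM we P0.
move=> i; rewrite mulrDr coefD coefMX coefMC mulrDl /=; apply: val_gtD; last first.
  by rewrite mulrAC Defs.valM; apply: vlt_leD => //; rewrite ?(vlt_fin et) // we vle_refl.
rewrite exprSr mulrA Defs.valM; apply: vle_ltD => //.
case: i => [|i]; last exact: vltW.
by rewrite mulr1 P0 vle_refl.
Qed.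

Lemma gauss_le_prod (a : R) (s : seq R) :
  (forall e, e \in s -> vle (w (t + e)) (w t)) ->
  gauss_le (a%:P * \prod_(e <- s) ('X + e%:P)).
Proof.
elim/last_ind: s => [_|s e IH es]; last first.
  rewrite big_rcons /= mulrA; apply: gauss_leM; last by apply: es; rewrite mem_rcons inE eqxx.
  by apply: IH => e' e's; apply: es; rewrite mem_rcons inE e's orbT.
rewrite big_nil mulr1 => -[|i]; first by rewrite hornerC coefC mulr1 vle_refl.
by rewrite coefC mul0r val0 vleNone.
Qed.

Lemma gauss_lt_prod (a : R) (s : seq R) : w a != None ->
  (forall e, e \in s -> vlt (w (t + e)) (w t)) ->
  gauss_lt (a%:P * \prod_(e <- s) ('X + e%:P)).
Proof.
move=> afin; elim/last_ind: s => [_|s e IH es]; last first.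
  rewrite big_rcons /= mulrA; apply: gauss_ltM; last by apply: es; rewrite mem_rcons inE eqxx.
  by apply: IH => e' e's; apply: es; rewrite mem_rcons inE e's orbT.
rewrite big_nil mulr1 /gauss_lt hornerC coefC; split=> //; split=> // i.
by rewrite coefC mul0r val0 vltNone.
Qed.

End Gauss.

Lemma seq_max (T : eqType) (G : oagType) (F : T -> option G) (s : seq T) : s != [::] ->
  exists2 x, x \in s & forall y, y \in s -> vle (F y) (F x).
Proof.
elim: s => // x [|y s] IH _; first by exists x; rewrite ?inE // => z; rewrite inE => /eqP ->; exact: vle_refl.
have [//|z zs zmax] := IH.
have [xz|zx] := boolP (vle (F x) (F z)).
  exists z => [|u]; first by rewrite inE zs orbT.
  by rewrite inE => /orP[/eqP ->|/zmax].
exists x => [|u]; first by rewrite inE eqxx.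
rewrite inE => /orP[/eqP ->|/zmax uz]; first exact: vle_refl.
by apply: vltW; exact: vle_lt_trans uz zx.
Qed.

Lemma comp_poly_shift (R : comNzRingType) (f : {poly R}) (c : R) :
  (f \Po ('X + c%:P)) \Po ('X - c%:P) = f.
Proof. by rewrite -comp_polyA comp_polyD comp_polyX comp_polyC subrK comp_polyXr. Qed.

(** * Domination of roots in pure extensions *)

Section Purity.
Variables (G : oagType) (K : fieldType) (L : fieldExtType K).
Variables (C : closedFieldType) (iota : {rmorphism L -> C}).
Variables (v : valuation G L) (eta : L) (nubar : valuation G {poly C}).
Hypothesis nubar_ext : extends_nu iota v eta nubar.

Local Notation j := (base_embed iota).
Local Notation evL f := (map_poly (in_alg L) f).[eta].
Local Notation shift f c := (f \Po ('X + c%:P)).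

Lemma nubar_linear (c : K) : nubar ('X - (j c)%:P) = v (eta - c%:A).
Proof.
by have := nubar_ext ('X - c%:P); rewrite !rmorphB /= !map_polyX !map_polyC /= !hornerE.
Qed.

(** The Taylor expansion of f around c, as a polynomial over C[X] to be evaluated at X - c, so that
    the Gauss lemma applies to [nubar]. *)
Definition shift_poly (f : {poly K}) (c : K) : {poly {poly C}} :=
  map_poly polyC (map_poly j (shift f c)).

Lemma shift_polyE f c (r : seq C) :
  map_poly j f = lead_coef (map_poly j f) *: \prod_(b <- r) ('X - b%:P) ->
  shift_poly f c = (lead_coef (map_poly j f))%:P%:P *
    \prod_(e <- [seq (j c - b)%:P | b <- r]) ('X + e%:P).
Proof.
move=> fr; rewrite /shift_poly map_comp_poly rmorphD /= map_polyX map_polyC /= {1}fr.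
rewrite comp_polyZ map_polyZ mul_polyC; congr (_ *: _).
rewrite big_map rmorph_prod /= rmorph_prod /=; apply: eq_bigr => b _.
rewrite comp_polyB comp_polyX comp_polyC -addrA -polyCB rmorphD /=.
by rewrite map_polyX map_polyC.
Qed.

Lemma nubar_shift_poly f c : nubar (shift_poly f c).['X - (j c)%:P] = v (evL f).
Proof.
rewrite -/(comp_poly _ _) -nubar_ext; congr (nubar _).
by rewrite map_comp_poly rmorphD /= map_polyX map_polyC comp_poly_shift.
Qed.

Lemma nubar_shift_coef f c i :
  nubar ((shift_poly f c)`_i * ('X - (j c)%:P) ^+ i) =
  v (((shift f c)`_i)%:A * (eta - c%:A) ^+ i).
Proof.
have := nubar_ext (((shift f c)`_i)%:P * ('X - c%:P) ^+ i).
rewrite !rmorphM !rmorphXn !rmorphB /= !map_polyX !map_polyC /= hornerM horner_exp !hornerE.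
by move=> <-; rewrite coef_map /= coef_map.
Qed.

(** With t = X - c, a root b of f gives the linear factor with e = c - b, and t + e = X - b; the
    domination hypothesis is thus the one of the Gauss lemma. *)
Lemma shift_val_le f c :
  (forall b, root (map_poly j f) b -> vle (nubar ('X - b%:P)) (v (eta - c%:A))) ->
  forall i, vle (v (evL f)) (v (((shift f c)`_i)%:A * (eta - c%:A) ^+ i)).
Proof.
move=> dom i; have [r fr] := closed_field_poly_normal (map_poly j f).
rewrite -nubar_shift_coef -(nubar_shift_poly f c) (shift_polyE c fr).
apply: gauss_le_prod => e /mapP[b br ->]; rewrite polyCB addrA subrK nubar_linear.
by apply: dom; rewrite fr /root hornerZ (rootP _) ?mulr0 // root_prod_XsubC.
Qed.

Lemma shift_val_lt f c : f != 0 ->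
  (forall b, root (map_poly j f) b -> vlt (nubar ('X - b%:P)) (v (eta - c%:A))) ->
  [/\ v (evL f) != None, v (((shift f c)`_0)%:A) = v (evL f) &
   forall i, vlt (v (evL f)) (v (((shift f c)`_i.+1)%:A * (eta - c%:A) ^+ i.+1))].
Proof.
move=> f0 dom; have [r fr] := closed_field_poly_normal (map_poly j f).
have [||fin [E0 lt]] := @gauss_lt_prod _ _ nubar ('X - (j c)%:P)
    (lead_coef (map_poly j f))%:P [seq (j c - b)%:P | b <- r].
- rewrite lead_coef_map; have := nubar_ext (lead_coef f)%:P.
  rewrite !map_polyC /= hornerC => ->.
  by rewrite (val_infty v) scaler_eq0 oner_eq0 orbF lead_coef_eq0.
- move=> e /mapP[b br ->]; rewrite polyCB addrA subrK nubar_linear.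
  by apply: dom; rewrite fr /root hornerZ (rootP _) ?mulr0 // root_prod_XsubC.
move: fin E0 lt; rewrite -(shift_polyE c fr) nubar_shift_poly => fin E0 lt.
split=> // [|i]; last by rewrite -nubar_shift_coef.
by have := nubar_shift_coef f c 0; rewrite !expr0 !mulr1 => <-.
Qed.

(** The default of [xget] does not arise: the roots of a nonconstant f form a finite nonempty list,
    on which the maximum is attained. *)
Lemma epsP (f : {poly K}) : (1 < size f)%N ->
  (exists2 a, root (map_poly j f) a & nubar ('X - a%:P) = eps iota nubar f) /\
  (forall a, root (map_poly j f) a -> vle (nubar ('X - a%:P)) (eps iota nubar f)).
Proof.
move=> sf; rewrite /eps; case: xgetP => [g _ []//|noP]; exfalso.
have [r fr] := closed_field_poly_normal (map_poly j f).
have rootr a : root (map_poly j f) a = (a \in r).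
  rewrite fr rootZ ?root_prod_XsubC // lead_coef_eq0 map_poly_eq0 -size_poly_gt0.
  exact: ltnW.
have r0 : r != [::].
  have /closed_rootP[a] : size (map_poly j f) != 1%N by rewrite size_map_poly neq_ltn sf orbT.
  by rewrite rootr; case: (r).
have [a ar amax] := seq_max (fun a => nubar ('X - a%:P)) r0.
apply: (noP (nubar ('X - a%:P))); split; first by exists a; rewrite ?rootr.
by move=> b; rewrite rootr; exact: amax.
Qed.

Hypothesis no_key : forall m, (1 < m < \dim {:L})%N ->
  ~ exists2 Q, key_polynomial iota nubar Q & (size Q).-1 = m.

(* A polynomial of minimal degree whose eps exceeds all v(eta - c) is a key polynomial. *)
Lemma eps_dominated (f : {poly K}) : (1 < size f <= \dim {:L})%N ->
  exists c : K, vle (eps iota nubar f) (v (eta - c%:A)).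
Proof.
have [n] := ubnP (size f); elim: n f => // n IH f /ltnSE fn /andP[sf fd].
apply: contrapT => none.
have f0 : f != 0 by rewrite -size_poly_gt0; exact: ltnW.
have above c : vlt (v (eta - c%:A)) (eps iota nubar f).
  by apply: contraT; rewrite negbK => le; case: none; exists c.
(* In degree one, outside the range of [no_key], the only root lies in K and serves as c. *)
have [s2|s2] := eqVneq (size f) 2.
  apply: none; have [[a fa <-] _] := epsP sf.
  exists (- f`_0 / f`_1); rewrite -nubar_linear.
  suff -> : a = j (- f`_0 / f`_1) by exact: vle_refl.
  have f1 : f`_1 != 0 by move: f0; rewrite -lead_coef_eq0 /lead_coef s2.
  have j1 : j f`_1 != 0 by rewrite fmorph_eq0.
  apply: (mulIf j1); rewrite -rmorphM divfK // rmorphN.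
  move: fa => /rootP; rewrite (@horner_coef_wide _ 2) ?size_map_poly ?s2 //.
  rewrite !big_ord_recl big_ord0 addr0 /= !coef_map /= mulr1 expr1 => /eqP.
  by rewrite addrC addr_eq0 mulrC => /eqP.
have l0 : (lead_coef f)^-1 != 0 by rewrite invr_eq0 lead_coef_eq0.
pose Q := (lead_coef f)^-1 *: f.
have sQ : size Q = size f by rewrite size_scale.
have epsQ : eps iota nubar Q = eps iota nubar f.
  rewrite /eps; congr xget; apply/seteqP; split=> g /= [[a]].
    rewrite map_polyZ rootZ ?fmorph_eq0 // => fa ga amax; split; first by exists a.
    by move=> b fb; apply: amax; rewrite rootZ ?fmorph_eq0.
  move=> fa ga amax; split; first by exists a; rewrite // map_polyZ rootZ ?fmorph_eq0.
  by move=> b; rewrite map_polyZ rootZ ?fmorph_eq0 //; exact: amax.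
apply: (no_key (m := (size Q).-1)).
  by rewrite sQ; case: (size f) sf s2 fd => [|[|[|k]]].
exists Q => //; split.
- by rewrite monicE lead_coefZ mulVf ?lead_coef_eq0.
- by rewrite sQ.
move=> h sh; rewrite sQ epsQ => hf.
have [||c hc] := IH h.
- exact: leq_trans hf fn.
- by rewrite sh (leq_trans (ltnW hf)).
exact: vle_lt_trans hc (above c).
Qed.

Lemma roots_dominated (f : {poly K}) : (size f <= \dim {:L})%N -> f != 0 ->
  exists c : K, forall b, root (map_poly j f) b -> vle (nubar ('X - b%:P)) (v (eta - c%:A)).
Proof.
move=> fd f0; have [sf|sf] := ltnP 1 (size f).
  have [|c ec] := @eps_dominated f; first by rewrite sf.
  by exists c => b fb; apply: vle_trans ec; case: (epsP sf) => _; apply.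
exists 0 => b; move: f0; rewrite (size1_polyC sf) polyC_eq0 map_polyC rootC fmorph_eq0.
by move/negPf ->.
Qed.

End Purity.

(** * Henselizations and conjugates *)

Section Generator.
Variables (K : fieldType) (L : fieldExtType K) (eta : L).
Hypothesis eta_gen : is_generator eta.

Local Notation evL f := (map_poly (in_alg L) f).[eta].

Lemma adjoin_degree_generator : adjoin_degree 1 eta = \dim {:L}.
Proof. by rewrite -[LHS]muln1 -[X in (_ * X)%N](dimv1 L) -dim_Fadjoin eta_gen. Qed.

Lemma generator_poly z : exists2 f : {poly K}, (size f <= \dim {:L})%N & evL f = z.
Proof.
have /polyOver1P[f fE] := Fadjoin_polyOver 1 eta z.
exists f; last by rewrite -fE Fadjoin_poly_eq // eta_gen memvf.
by rewrite -(size_map_poly (in_alg L)) -fE -adjoin_degree_generator size_Fadjoin_poly.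
Qed.

Lemma generator_minpoly : exists g : {poly K}, [/\ g \is monic, size g = (\dim {:L}).+1
  & forall f, (evL f == 0) = (g %| f)].
Proof.
have /polyOver1P[g gE] := minPolyOver 1 eta.
have sg : size g = (\dim {:L}).+1.
  by rewrite -(size_map_poly (in_alg L)) -gE size_minPoly adjoin_degree_generator.
exists g; split=> //.
  by have := monic_minPoly 1 eta; rewrite gE map_monic.
move=> f; rewrite -(dvdp_map (in_alg L)) -gE; apply/idP/idP.
  by apply: minPoly_dvdp; apply/polyOver1P; exists f.
by move=> /dvdpP[k ->]; rewrite hornerM minPolyxx mulr0.
Qed.

End Generator.

Section HenselizationDegree.
Variables (G : oagType) (K : fieldType) (L : fieldExtType K) (C : closedFieldType).
Variables (iota : {rmorphism L -> C}) (vbar : valuation G C).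
Local Notation j := (base_embed iota).

(* If b is a one-element basis of L^h over K^h, then b and x b lie in L^h for x in L, and
   x b = c b with c in K^h gives x = c. *)
Lemma henselization_degree1 :
  degree (henselization vbar j) (henselization vbar iota) = 1%N ->
  forall x : L, henselization vbar j (iota x).
Proof.
rewrite /degree; case: xgetP => [n _ [b [bL bU]] n1|//] x; subst n.
have sep_linear y : separable_over iota (iota y).
  exists ('X - y%:P); first by rewrite separable_poly.unlock derivXsubC coprimep1.
  by rewrite rmorphB /= map_polyX map_polyC root_XsubC.
have [[p sep_p pb] b_fix] := bL ord0.
have b0 : b ord0 != 0.
  have one : henselization vbar iota 1.
    by split; [rewrite -(rmorph1 iota)|move=> s _ _ _; rewrite rmorph1].
  have [c [[_ +] _]] := bU 1 one; rewrite big_ord1 => /eqP.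
  by apply: contraTneq => ->; rewrite mulr0 oner_eq0.
have [|c [[cK +] _]] := bU (iota x * b ord0); last by rewrite big_ord1 => /(mulIf b0) ->.
split=> [|s bij_s sj sv]; last by rewrite rmorphM sj b_fix.
have [->|x0] := eqVneq x 0; first by rewrite rmorph0 mul0r -(rmorph0 iota).
have x1 : x^-1 != 0 by rewrite invr_eq0.
(* The polynomial p(X/x) vanishes at x b and stays separable by the chain rule. *)
exists (p \Po (x^-1 *: 'X)).
  rewrite separable_poly.unlock deriv_comp derivZ derivX alg_polyC mulrC mul_polyC coprimepZr //.
  by apply: coprimep_comp_poly; move: sep_p; rewrite separable_poly.unlock.
rewrite map_comp_poly map_polyZ map_polyX /= /root horner_comp hornerZ hornerX.
by rewrite fmorphV mulKf ?fmorph_eq0.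
Qed.

End HenselizationDegree.

Section ResidueDegree.
Variables (G : oagType) (K : fieldType) (L : fieldExtType K) (v : valuation G L).

(** Here Kv is all of Lv, so 1 is a basis. As [degree] picks the size of some basis, all other sizes
    have to be excluded too. *)
Lemma residue_degree1 :
  (forall z, z \in valring v -> exists c : K, vlt (Some 0) (v (z - c%:A))) ->
  residue_degree v = 1%N.
Proof.
move=> immediate.
have full (x : residue v) : base_residue x.
  have z_val := valring_valP (repr x); have [c zc] := immediate _ z_val.
  have c_val : c%:A \in valring v.
    have -> : c%:A = valring_val (repr x) - (valring_val (repr x) - c%:A) by rewrite subKr.
    by rewrite rpredB // unfold_in /valring; exact: vltW.
  exists (ValRing c_val); first by exists c.
  rewrite -[x in RHS]reprK; apply/eqP; rewrite eq_sym -Quotient.idealrBE.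
  by rewrite unfold_in /maxidealT.
rewrite /residue_degree /degree; case: xgetP => [n _ [b [_ bU]]|none]; last first.
  exfalso; apply: (none 1%N); exists (fun=> 1); split=> // x _.
  exists [ffun=> x]; split=> [|c [_ ->]].
    by split=> [i|]; rewrite ?big_ord1 ?ffunE ?mulr1.
  by apply/ffunP => i; rewrite ord1 ffunE big_ord1 mulr1.
case: n b bU => [|[|n]] // b bU.
  have [c [[_ +] _]] := bU 1 I; rewrite big_ord0 => /eqP.
  by rewrite oner_eq0.
(* With all of Lv as scalars, b1 b0 - b0 b1 = 0 is a relation, so b1 = 0 by uniqueness; then the
   coefficient 1 at b1 expresses 0 in a second way. *)
pose i0 : 'I_n.+2 := ord0; pose i1 : 'I_n.+2 := lift ord0 ord0.
have [c [_ cU]] := bU 0 I.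
have c0 : c = [ffun=> 0].
  apply: cU; split=> [i|]; first exact: full.
  by rewrite big1 // => i _; rewrite ffunE mul0r.
have b1 : b i1 = 0.
  have := cU [ffun i => if i == i0 then b i1 else if i == i1 then - b i0 else 0].
  rewrite c0 => /(_ _)/ffunP/(_ i0); rewrite !ffunE eqxx => -> //.
  split=> [i|]; first exact: full.
  rewrite big_ord_recl big_ord_recl big1 ?addr0 => [|i _]; last by rewrite ffunE mul0r.
  by rewrite !ffunE mulNr mulrC subrr.
have := cU [ffun i => (i == i1)%:R].
rewrite c0 => /(_ _)/ffunP/(_ i1); rewrite !ffunE eqxx => E.
have /eqP : 0 = 1 :> residue v.
  apply: E; split=> [i|]; first exact: full.
  rewrite (bigD1 i1) //= b1 mulr0 add0r big1 // => i /negPf iN.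
  by rewrite ffunE iN mul0r.
by rewrite eq_sym oner_eq0.
Qed.

End ResidueDegree.

Lemma taylor_shift (K R : comNzRingType) (h : {rmorphism K -> R}) (f : {poly K}) c x :
  (map_poly h f).[x] =
  \sum_(i < size (f \Po ('X + c%:P))) h (f \Po ('X + c%:P))`_i * (x - h c) ^+ i.
Proof.
rewrite -[f in LHS](comp_poly_shift f c) map_comp_poly horner_comp.
rewrite rmorphB /= map_polyX map_polyC hornerXsubC.
rewrite (@horner_coef_wide _ (size (f \Po ('X + c%:P)))) ?size_poly //.
by apply: eq_bigr => i _; rewrite coef_map.
Qed.

Section Conjugates.
Variables (G : oagType) (K : fieldType) (L : fieldExtType K).
Variables (C : closedFieldType) (iota : {rmorphism L -> C}).
Variables (v : valuation G L) (vbar : valuation G C) (eta : L).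
Hypothesis hC : is_alg_closure iota.
Hypothesis hvbar : forall x, vbar (iota x) = v x.

Local Notation j := (base_embed iota).
Local Notation evL f := (map_poly (in_alg L) f).[eta].
Local Notation shift f c := (f \Po ('X + c%:P)).

(** The constant term of the expansion is f(c); it decides the value of f at eta and at every point
    as close to c as eta is. *)
Definition approximates (f : {poly K}) (c : K) :=
  [/\ v (evL f) != None, v (((shift f c)`_0)%:A) = v (evL f) &
   forall i, vlt (v (evL f)) (v (((shift f c)`_i.+1)%:A * (eta - c%:A) ^+ i.+1))].

Hypothesis approximable : forall f : {poly K}, f != 0 -> (size f <= \dim {:L})%N ->
  exists c, approximates f c.

Lemma map_base_horner (f : {poly K}) : (map_poly j f).[iota eta] = iota (evL f).
Proof. by rewrite map_poly_comp horner_map. Qed.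

(* Conjugates at least as close to eta as all of K give the same values to polynomials
   of degree less than n. *)
Lemma close_conjugate (g : {poly K}) (b : C) :
  (forall f, (evL f == 0) = (g %| f)) -> size g = (\dim {:L}).+1 ->
  root (map_poly j g) b ->
  (forall c : K, vle (v (eta - c%:A)) (vbar (iota eta - b))) ->
  exists s : {rmorphism C -> C}, [/\ bijective s, forall y, vbar (s y) = vbar y,
    forall c, s (j c) = j c & s (iota eta) = b].
Proof.
move=> gP sg gb close.
(* The point b is at least as close to c as eta is, because b - c = (eta - c) - (eta - b). *)
have b_close c i : vle (v ((eta - c%:A) ^+ i)) (vbar ((b - j c) ^+ i)).
  elim: i => [|i IH]; first by rewrite Defs.val1 Defs.val1 vle_refl.
  rewrite !exprS [v _]Defs.valM [vbar _]Defs.valM; apply: vleD => //.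
  have -> : b - j c = iota (eta - c%:A) - (iota eta - b).
    by rewrite rmorphB /=; ring.
  by apply: val_geB; rewrite ?hvbar ?vle_refl.
have val_b f : vbar (map_poly j f).[b] = v (evL f).
  have g0 : g != 0 by rewrite -size_poly_gt0 sg.
  (* Since g kills both eta and b, f may be taken of degree less than n; an approximating c then
     gives f the value of f(c) at both points. *)
  have -> : evL f = evL (modp f g).
    have : evL (divp f g * g) = 0 by apply/eqP; rewrite gP dvdp_mull.
    by rewrite {2}(divp_eq f g) rmorphD hornerD /= => ->; rewrite add0r.
  have -> : (map_poly j f).[b] = (map_poly j (modp f g)).[b].
    by rewrite {1}(divp_eq f g) rmorphD rmorphM hornerD hornerM (rootP gb) mulr0 add0r.
  have sm : (size (modp f g) <= \dim {:L})%N by rewrite -ltnS -sg ltn_modp.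
  move: (modp f g) sm => {}f sf; have [->|f0] := eqVneq f 0.
    by rewrite !rmorph0 !horner0 !val0.
  have [c [fin f_0 f_lt]] := approximable f0 sf.
  rewrite (taylor_shift j f c b).
  case E: (size (shift f c)) => [|n].
    by move: f0; rewrite -size_poly_gt0 -(size_comp_poly2 f (size_XaddC c)) E.
  rewrite big_ord_recl mulr1 -f_0 val_addl ?hvbar //.
  rewrite f_0; apply: val_gt_sum => // i _; apply: vlt_le_trans (f_lt i) _.
  by rewrite [v _]Defs.valM [vbar _]Defs.valM hvbar; apply: vleD; rewrite ?vle_refl.
pose g0 := [set ((map_poly j f).[iota eta], (map_poly j f).[b]) | f in [set: {poly K}]].
have [||s [bij_s sv sE]] := @isometry_extension _ _ vbar _ j hC g0.
- split.
  + by exists 1 => //; rewrite !rmorph1 !hornerC.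
  + by move=> _ _ [f _ <-] [f' _ <-]; exists (f - f') => //; rewrite !rmorphB !hornerD !hornerN.
  + by move=> _ _ [f _ <-] [f' _ <-]; exists (f * f') => //; rewrite !rmorphM !hornerM.
  + by move=> _ [f _ <-] /=; rewrite val_b map_base_horner hvbar.
- by move=> c; exists c%:P => //; rewrite !map_polyC !hornerC.
exists s; split=> //.
  by move=> c; apply: (sE (j c, j c)); exists c%:P => //; rewrite !map_polyC !hornerC.
by apply: (sE (iota eta, b)); exists 'X => //; rewrite !map_polyX !hornerX.
Qed.

End Conjugates.

(** * Value groups and generators of the valuation ring *)

(** Infinite sets have [ncard] 0, so a nonzero count certifies finiteness. *)
Lemma ncard_finite (T : choiceType) (X : set T) : ncard X != 0%N -> finite_set X.
Proof. by rewrite /ncard /fset_set; case: pselect => // _; rewrite cardfs0. Qed.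

Section ValueGroups.
Variables (G : oagType) (K : fieldType) (L : fieldExtType K) (v : valuation G L).
Local Notation Gamma := (value_group v).
Local Notation Delta := (base_value_group v).
Local Notation coset g := [set g + d | d in Delta].

Lemma base_value_group0 : Delta 0.
Proof. by exists 1; rewrite scale1r Defs.val1. Qed.

Lemma base_value_groupD g h : Delta g -> Delta h -> Delta (g + h).
Proof.
move=> [c cg] [d dh]; exists (c * d).
by rewrite (rmorphM (in_alg L) c d : (c * d)%:A = _) Defs.valM cg dh.
Qed.

Lemma base_value_groupN g : Delta g -> Delta (- g).
Proof.
move=> [c cg]; have c0 : c%:A != 0 :> L by rewrite -(val_infty v) cg.
exists c^-1; rewrite (fmorphV (in_alg L) c : (c^-1)%:A = _).
have := Defs.valM v c%:A (c%:A)^-1; rewrite mulfV // Defs.val1 cg.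
case: (v _^-1) => //= h [gh]; congr Some; apply/eqP.
by rewrite -addr_eq0 addrC -gh.
Qed.

Lemma base_value_group_sub : Delta `<=` Gamma.
Proof. by move=> g [c cg]; exists c%:A. Qed.

Lemma mem_coset g : coset g g.
Proof. by exists 0; rewrite ?addr0 //; exact: base_value_group0. Qed.

Lemma ramification_index1 :
  (forall z, z != 0 -> exists c : K, v c%:A = v z) -> ramification_index v = 1%N.
Proof.
move=> immediate; rewrite /ramification_index /group_index.
suff -> : [set coset g | g in Gamma] = [set Delta] by rewrite /ncard fset_set1 cardfs1.
have full g : Gamma g -> Delta g.
  move=> [z zg]; have [|c cz] := immediate z; last by exists c; rewrite cz.
  by rewrite -(val_infty v) zg.
have cosetE g : Delta g -> coset g = Delta.
  move=> gB; apply/seteqP; split=> [_ [d dB <-]|d dB]; first exact: base_value_groupD.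
  exists (- g + d); last by rewrite addNKr.
  by apply: base_value_groupD => //; exact: base_value_groupN.
apply/seteqP; split=> [_ [g /full gB <-]|_ ->]; first exact: cosetE.
by exists 0; [exact: base_value_group_sub base_value_group0|exact: cosetE base_value_group0].
Qed.

(* Distinct elements of the initial segment lie in distinct cosets, so if there are
   (Gamma : Delta) of them then they represent all cosets. *)
Lemma initial_representative : ramification_index v != 0%N ->
  ramification_index v = ext_initial_index v -> forall g, Gamma g ->
  exists h d, [/\ 0 <= h, forall d, Delta d -> 0 < d -> h < d, Delta d & g = h + d].
Proof.
rewrite /ramification_index /ext_initial_index /group_index /initial_index.
set Cs := [set coset g | g in Gamma]; set I := [set g | _] => e0 eE g gG.
have finC := ncard_finite e0; have finI : finite_set I by apply: ncard_finite; rewrite -eE.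
have inj : {in fset_set I &, injective (fun h => coset h)}.
  move=> h h'; rewrite !in_fset_set // !inE => hI hI' E.
  have [d dB hd] : coset h' h by rewrite -E; exact: mem_coset.
  have hd' : h' = h - d by rewrite -hd addrK.
  (* Elements of I are nonnegative and below all positive elements of Delta, so their difference is
     never a positive element of Delta. *)
  have ndelta k k' e : I k -> I k' -> k = k' + e -> Delta e -> ~~ (0 < e).
    move=> [_ _ klt] [_ k'0 _] kE eB; apply/negP => e0'.
    have := klt e eB e0'; rewrite kE oag_ltNge => /negP; apply.
    by rewrite -{1}[e]add0r ![_ + e]addrC oag_leD2l.
  have d0 := ndelta _ _ _ hI hI' (esym hd) dB.
  have d0' := ndelta _ _ _ hI' hI hd' (base_value_groupN dB).
  suff : d = 0 by move=> d00; rewrite -hd d00 addr0.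
  have dle : d <= 0 by move: d0; rewrite oag_ltNge negbK.
  have dge : 0 <= d by move: d0'; rewrite oag_ltNge negbK -(oag_leD2l d) subrr addr0.
  by apply/le_anti/andP.
have sub : ([fset coset h | h in fset_set I] `<=` fset_set Cs)%fset.
  apply/fsubsetP => y /imfsetP[h /=]; rewrite in_fset_set // inE => -[hG _ _] ->.
  by rewrite in_fset_set // inE; exists h.
have /fsetP E : [fset coset h | h in fset_set I]%fset = fset_set Cs.
  by apply/eqP; rewrite eqEfcard sub /= card_in_imfset //; move: eE; rewrite /ncard => ->.
have : coset g \in fset_set Cs by rewrite in_fset_set // inE; exists g.
rewrite -E => /imfsetP[h /=]; rewrite in_fset_set // inE => -[_ h0 hlt] gh.
have [d dB hd] : coset h g by rewrite -gh; exact: mem_coset.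
by exists h, d.
Qed.

(** By the pigeonhole principle two of the e + 1 powers from x^0 to x^e have values in the same
    coset; their quotient is the required power. *)
Lemma power_in_base (x : L) : ramification_index v != 0%N -> v x != None ->
  exists k, (0 < k <= ramification_index v)%N /\ exists g, v (x ^+ k) = Some g /\ Delta g.
Proof.
rewrite /ramification_index /group_index.
set Cs := [set coset g | g in Gamma] => e0 xfin; have finC := ncard_finite e0.
have xX k : exists g, v (x ^+ k) = Some g.
  have : v (x ^+ k) != None.
    elim: k => [|k IH]; first by rewrite Defs.val1.
    by rewrite exprS Defs.valM vadd_fin xfin.
  by case: (v _) => // g _; exists g.
have [f fE] := choice xX.
set e := #|` fset_set Cs|.
pose s := [seq coset (f k) | k <- iota 0 e.+1].
have sub : {subset s <= fset_set Cs}.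
  move=> _ /mapP[k _ ->]; rewrite in_fset_set // inE; exists (f k) => //.
  by exists (x ^+ k).
have : ~~ uniq s.
  apply/negP => us; have := uniq_leq_size us sub.
  by rewrite size_map size_iota ltnn.
move=> /(uniqPn setT)[k [l [kl]]]; rewrite size_map size_iota => le.
have ke := ltn_trans kl le.
rewrite !(nth_map 0%N) ?size_iota // !nth_iota // !add0n => E.
have [d dB dE] : coset (f k) (f l) by rewrite E; exact: mem_coset.
exists (l - k)%N; split.
  by rewrite subn_gt0 kl (leq_trans (leq_subr _ _)).
exists d; split=> //.
have := fE l; rewrite -(subnK (ltnW kl)) exprD Defs.valM !fE subnK ?(ltnW kl) // -dE.
by move=> [hk]; congr Some; apply: (addIr (f k)); rewrite hk addrC.
Qed.

End ValueGroups.

Section Adjoin.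
Variables (R : nzRingType) (A S : set R).

Lemma adjoin_base x : A x -> adjoin A S x.
Proof. by move=> Ax B [_]; apply; left. Qed.

Lemma adjoin_gen x : S x -> adjoin A S x.
Proof. by move=> Sx B [_]; apply; right. Qed.

Lemma adjoin1 : adjoin A S 1.
Proof. by move=> B BP; have [[B1 _ _] _] := BP; exact: set_mem B1. Qed.

Lemma adjoinB x y : adjoin A S x -> adjoin A S y -> adjoin A S (x - y).
Proof.
move=> Ax Ay B BP; have [[_ BB _] _] := BP; apply: set_mem.
by apply: BB; apply: mem_set; [exact: Ax|exact: Ay].
Qed.

Lemma adjoinM x y : adjoin A S x -> adjoin A S y -> adjoin A S (x * y).
Proof.
move=> Ax Ay B BP; have [[_ _ BM] _] := BP; apply: set_mem.
by apply: BM; apply: mem_set; [exact: Ax|exact: Ay].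
Qed.

Lemma adjoin0 : adjoin A S 0.
Proof. by rewrite -(subrr 1); apply: adjoinB; exact: adjoin1. Qed.

Lemma adjoinD x y : adjoin A S x -> adjoin A S y -> adjoin A S (x + y).
Proof.
move=> Ax Ay; rewrite -[y]opprK; apply: adjoinB => //.
by rewrite -sub0r; apply: adjoinB => //; exact: adjoin0.
Qed.

Lemma adjoinX x n : adjoin A S x -> adjoin A S (x ^+ n).
Proof.
move=> Ax; elim: n => [|n IH]; first exact: adjoin1.
by rewrite exprS; exact: adjoinM.
Qed.

Lemma adjoin_sum (I : Type) (r : seq I) (P : pred I) (F : I -> R) :
  (forall i, P i -> adjoin A S (F i)) -> adjoin A S (\sum_(i <- r | P i) F i).
Proof. by move=> AF; elim/big_ind: _ => //; [exact: adjoin0|exact: adjoinD]. Qed.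

End Adjoin.

Section Localize.
Variables (G : oagType) (K : fieldType) (L : fieldExtType K) (v : valuation G L).

Lemma valringE x : (x \in valring v) = vle (Some 0) (v x).
Proof. by []. Qed.

Lemma val_inv x : v x != None -> vadd (v x) (v x^-1) = Some 0.
Proof.
by rewrite (val_infty v) => x0; rewrite -Defs.valM mulfV ?Defs.val1.
Qed.

Lemma val_unit_inv x : v x = Some 0 -> v x^-1 = Some 0.
Proof. by move=> x0; have := @val_inv x; rewrite x0 vadd0; apply. Qed.

Lemma not_maxideal x : (x \notin maxideal v) = vle (v x) (Some 0).
Proof. by rewrite unfold_in /maxideal /vlt negbK. Qed.

Lemma adjoin_valring (S : set L) : S `<=` [set` valring v] ->
  adjoin (base_valring v) S `<=` [set` valring v].
Proof.
move=> SO x; apply; split.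
  have [h1 hB hM] := valring_subring v.
  split=> [|y z|y z]; rewrite !inE /=; [exact: h1|exact: hB|exact: hM].
by move=> y [[c cO <-]|/SO].
Qed.

Lemma localize_valring (A : set L) : A `<=` [set` valring v] ->
  localize v A `<=` [set` valring v].
Proof.
move=> AO x [a [b [Aa Ab + ->]]]; rewrite not_maxideal => b0 /=.
have b0' : vle (Some 0) (v b) by exact: AO.
have vb : v b = Some 0 by apply: vle_anti; rewrite b0.
by rewrite valringE; apply: val_ge0M; [exact: AO|rewrite val_unit_inv ?vle_refl].
Qed.

Lemma sub_localize (A : set L) : A 1 -> A `<=` localize v A.
Proof.
by move=> A1 x Ax; exists x, 1; rewrite divr1 not_maxideal Defs.val1 vle_refl.
Qed.

End Localize.

Section MonomialGenerators.
Variables (G : oagType) (K : fieldType) (L : fieldExtType K) (v : valuation G L).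

Lemma scaleVE (c : K) : (c^-1)%:A = (c%:A)^-1 :> L.
Proof. exact: (fmorphV (in_alg L) c). Qed.

Lemma scaleME (c d : K) : (c * d)%:A = c%:A * d%:A :> L.
Proof. exact: (rmorphM (in_alg L) c d). Qed.

Lemma scaleXE (c : K) n : (c ^+ n)%:A = c%:A ^+ n :> L.
Proof. exact: (rmorphXn (in_alg L) n c). Qed.

Lemma scale_eq0 (c : K) : (c%:A == 0 :> L) = (c == 0).
Proof. by rewrite scaler_eq0 oner_eq0 orbF. Qed.

(** If m had a negative value d, then h < -d, and m y would have negative value h + d. *)
Lemma base_coef_ge0 (m : K) (y : L) h : v y = Some h ->
  (forall d, base_value_group v d -> 0 < d -> h < d) ->
  vle (Some 0) (v (m%:A * y)) -> vle (Some 0) (v m%:A).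
Proof.
move=> vy hlt; rewrite Defs.valM vy; case E: (v m%:A) => [d|] //= dh.
rewrite -[_ <= _]negbK -oag_ltNge; apply/negP => d0.
have : h < - d.
  apply: hlt; first by apply: base_value_groupN; exists m.
  by rewrite -(oag_ltD2l d) subrr addr0.
by rewrite -(oag_ltD2l d) subrr oag_ltNge dh.
Qed.

(* If v(x^k) lies in vK, then x^i = (x^k)^q x^r, and c x^i lies in O_L only if the
   normalized coefficient c a_k^q a_r lies in O_K. *)
Theorem monomial_generators (x : L) : v x != None ->
  ramification_index v != 0%N -> ramification_index v = ext_initial_index v ->
  (forall z, z \in valring v -> exists f : {poly K},
     z = \sum_(i < size f) (f`_i)%:A * x ^+ i /\
     forall i, vle (Some 0) (v ((f`_i)%:A * x ^+ i))) ->
  exists a : nat -> K,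
    (forall l, (1 <= l <= ramification_index v)%N -> a l != 0 /\ x ^+ l / (a l)%:A \in valring v) /\
    [set` valring v] = localize v (adjoin (base_valring v)
       [set x ^+ l / (a l)%:A | l in [set l | (1 <= l <= ramification_index v)%N]]).
Proof.
move=> xfin e0 eE rep.
have xX k : exists g, v (x ^+ k) = Some g.
  have : v (x ^+ k) != None.
    elim: k => [|k IH]; first by rewrite Defs.val1.
    by rewrite exprS Defs.valM vadd_fin xfin.
  by case: (v _) => // g _; exists g.
(* Dividing x^l by a suitable a_l moves its value into the initial segment, where [base_coef_ge0]
   applies. *)
have /choice[a aP] : forall l, exists c : K, c != 0 /\ exists h, [/\ v (x ^+ l / c%:A) = Some h,
    0 <= h & forall d, base_value_group v d -> 0 < d -> h < d].
  move=> l; have [g xg] := xX l.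
  have [|h [d [h0 hlt [c cd] gE]]] := initial_representative e0 eE (g := g).
    by exists (x ^+ l).
  have c0 : c != 0 by rewrite -scale_eq0 -(val_infty v) cd.
  exists c; split=> //; exists h; split=> //; apply: (@vaddI _ _ _ (v c%:A)).
    by rewrite cd.
  by rewrite -Defs.valM divfK ?scale_eq0 // xg cd gE.
have a0 l : (a l)%:A != 0 :> L by rewrite scale_eq0; case: (aP l).
have aO l : vle (Some 0) (v (x ^+ l / (a l)%:A)) by have [_ [h [-> h0 _]]] := aP l.
have [k [/andP[k0 ke] [g [xk gB]]]] := power_in_base e0 xfin.
(* This value lies in vK and is nonnegative and below all positive elements of vK. *)
have uE : v (x ^+ k / (a k)%:A) = Some 0.
  have [_ [h [hE h0 hlt]]] := aP k; rewrite hE; congr Some.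
  have hB : base_value_group v h.
    have [c cg] := gB; exists (c / a k).
    by rewrite scaleME scaleVE -hE !Defs.valM cg xk.
  apply/eqP; rewrite eq_sym; apply: contraT => hN.
  by have := hlt h hB; rewrite lt_neqAle hN h0 ltxx => /(_ isT).
exists a; split=> [l _|]; first by split; [case: (aP l)|exact: aO].
set S := [set x ^+ l / (a l)%:A | l in _].
have gen l : (1 <= l <= ramification_index v)%N -> adjoin (base_valring v) S (x ^+ l / (a l)%:A).
  by move=> le; apply: adjoin_gen; exists l.
have AO : adjoin (base_valring v) S `<=` [set` valring v] by apply: adjoin_valring => _ [l _ <-]; exact: aO.
apply/seteqP; split; last exact: localize_valring.
move=> z /= zO; apply: sub_localize; first exact: adjoin1.
have [f [-> fO]] := rep z zO; apply: adjoin_sum => i _.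
pose q := (i %/ k)%N; pose r := (i %% k)%N.
have rk : (r < k)%N by rewrite ltn_mod.
have iE : x ^+ i = (x ^+ k) ^+ q * x ^+ r by rewrite -exprM -exprD mulnC -divn_eq.
pose m := f`_i * a k ^+ q * a r.
have E : (f`_i)%:A * x ^+ i = m%:A * ((x ^+ k / (a k)%:A) ^+ q * (x ^+ r / (a r)%:A)).
  rewrite iE !scaleME scaleXE exprMn exprVn.
  have ak0 : (a k)%:A ^+ q != 0 :> L by rewrite expf_neq0.
  by field; rewrite ?ak0 ?a0.
have [_ [h [hE h0 hlt]]] := aP r.
have mO : vle (Some 0) (v m%:A).
  apply: (base_coef_ge0 (y := (x ^+ k / (a k)%:A) ^+ q * (x ^+ r / (a r)%:A)) (h := h)) => //.
    by rewrite Defs.valM (val_unitX _ uE) vadd0.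
  by rewrite -E; exact: fO.
rewrite E; apply: adjoinM; first by apply: adjoin_base; exists m.
apply: adjoinM; first by apply: adjoinX; apply: gen; rewrite k0.
(* The generators start at l = 1; for r = 0 the factor 1 / a_0 lies in O_K. *)
have [r0|r0] := posnP r; last by apply: gen; rewrite r0 (leq_trans (ltnW rk)).
apply: adjoin_base; exists (a r)^-1; first by rewrite /= scaleVE -[_^-1]mul1r -(expr0 x) -{1}r0; exact: aO.
by rewrite scaleVE r0 expr0 mul1r.
Qed.

End MonomialGenerators.

(** * The immediate case *)

Section ImmediateCase.
Variables (G : oagType) (K : fieldType) (L : fieldExtType K).
Variables (C : closedFieldType) (iota : {rmorphism L -> C}).
Variables (v : valuation G L) (vbar : valuation G C) (eta : L).
Hypothesis hC : is_alg_closure iota.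
Hypothesis hvbar : forall x, vbar (iota x) = v x.
Hypothesis eta_gen : is_generator eta.

Local Notation j := (base_embed iota).
Local Notation evL f := (map_poly (in_alg L) f).[eta].
Local Notation shift f c := (f \Po ('X + c%:P)).

(** The prescribed [c1] allows approximations at least as close to eta as a centre fixed
    beforehand. *)
Hypothesis approx : forall f : {poly K}, f != 0 -> (size f <= \dim {:L})%N ->
  forall c1, exists c, vle (v (eta - c1%:A)) (v (eta - c%:A)) /\ approximates v eta f c.

Lemma immediate_approx z : z != 0 -> forall c1, exists c f,
  [/\ vle (v (eta - c1%:A)) (v (eta - c%:A)), approximates v eta f c & z = evL f].
Proof.
move=> z0 c1; have [f sf fz] := generator_poly eta_gen z.
have f0 : f != 0 by apply: contra_neq z0 => f0; rewrite -fz f0 rmorph0 horner0.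
by have [c [le ap]] := approx f0 sf c1; exists c, f.
Qed.

Lemma immediate_value z : z != 0 -> exists c : K, v c%:A = v z.
Proof.
by move=> /immediate_approx/(_ 0)[c [f [_ [_ E _] ->]]]; exists (shift f c)`_0.
Qed.

Lemma immediate_residue z : z \in valring v -> exists c : K, vlt (Some 0) (v (z - c%:A)).
Proof.
move=> zO; have [->|z0] := eqVneq z 0; first by exists 0; rewrite scale0r subr0 val0.
have [c [f [_ ap zf]]] := immediate_approx z0 0.
have [fin _ lt] := ap; rewrite -zf in fin lt.
exists (shift f c)`_0; have := taylor_shift (in_alg L) f c eta; rewrite -zf.
case: (size _) => [|n] zE; first by rewrite zE big_ord0 eqxx in z0.
rewrite {1}zE big_ord_recl mulr1 addrC addKr; apply: val_gt_sum => // i _.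
exact: vle_lt_trans zO (lt i).
Qed.

(** Otherwise [close_conjugate] gives an isometric K-automorphism taking eta to b, but elements of
    the henselization are fixed by it. *)
Lemma conjugate_bound (g : {poly K}) (b : C) : henselization vbar j (iota eta) ->
  (forall f, (evL f == 0) = (g %| f)) -> size g = (\dim {:L}).+1 ->
  root (map_poly j g) b -> b != iota eta ->
  exists c : K, vlt (vbar (iota eta - b)) (v (eta - c%:A)).
Proof.
move=> [_ fixed] gP sg gb bN; apply: contrapT => none; move/eqP: bN; apply.
have [|c|s [bij_s sv sj <-]] := close_conjugate hC hvbar _ gP sg gb.
- by move=> f f0 sf; have [c [_ ap]] := approx f0 sf 0; exists c.
- by apply: contraT => lt; case: none; exists c.
exact: fixed.
Qed.

Lemma separated_conjugates : henselization vbar j (iota eta) ->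
  exists (g : {poly K}) (s : seq C) (c : K),
  [/\ evL g = 0, map_poly j g = ('X - (iota eta)%:P) * \prod_(b <- s) ('X - b%:P)
    & forall b, b \in s -> vlt (vbar (iota eta - b)) (v (eta - c%:A))].
Proof.
move=> hens; have [g [mg sg gP]] := generator_minpoly eta_gen.
have g_eta : evL g = 0 by apply/eqP; rewrite gP.
have [r] := closed_field_poly_normal (map_poly j g).
rewrite lead_coef_map (monicP mg) rmorph1 scale1r => gr.
have eta_r : iota eta \in r.
  by rewrite -root_prod_XsubC -gr /root map_base_horner g_eta rmorph0.
(* Elements of the henselization are separable over K, so eta is a simple root of g and removing it
   once leaves only the other conjugates. *)
have ur : uniq r.
  have [[p sep_p p_eta] _] := hens.
  rewrite -separable_prod_XsubC -gr separable_map.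
  apply: dvdp_separable sep_p; rewrite -gP.
  by move: p_eta; rewrite /root map_base_horner fmorph_eq0.
exists g, (rem (iota eta) r).
have [c cP] : exists c : K, forall b, b \in rem (iota eta) r ->
    vlt (vbar (iota eta - b)) (v (eta - c%:A)).
  have : forall b, b \in rem (iota eta) r ->
      exists c : K, vlt (vbar (iota eta - b)) (v (eta - c%:A)).
    move=> b; rewrite mem_rem_uniq // !inE => /andP[bN br].
    by apply: (conjugate_bound hens gP sg) => //; rewrite gr root_prod_XsubC.
  elim: (rem _ _) => [|b s IH] bs; first by exists 0.
  have [c cs] : exists c : K, forall b, b \in s -> vlt (vbar (iota eta - b)) (v (eta - c%:A)).
    by apply: IH => b' b's; apply: bs; rewrite inE b's orbT.
  have [|c' cb] := bs b; first by rewrite inE eqxx.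
  have [le|le] := orP (vle_total (v (eta - c%:A)) (v (eta - c'%:A))).
    exists c' => b'; rewrite inE => /orP[/eqP->//|/cs lt]; exact: vlt_le_trans lt le.
  exists c => b'; rewrite inE => /orP[/eqP->|/cs//]; exact: vlt_le_trans cb le.
exists c; split=> //; rewrite gr.
by rewrite (perm_big _ (perm_to_rem eta_r)) big_cons.
Qed.

(** Around c, g becomes (X - t) Q with t = eta - c. The other conjugates are farther from eta than c
    is, so by the Gauss lemma the constant term of Q dominates at t. *)
Lemma linear_term_dominates (g : {poly K}) (s : seq C) (c : K) :
  map_poly j g = ('X - (iota eta)%:P) * \prod_(b <- s) ('X - b%:P) ->
  (forall b, b \in s -> vlt (vbar (iota eta - b)) (v (eta - c%:A))) ->
  v (eta - c%:A) != None ->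
  let T i := v (((shift g c)`_i)%:A * (eta - c%:A) ^+ i) in
  T 1%N != None /\ forall i, vlt (T 1%N) (T i.+2).
Proof.
move=> gs cs fin T; pose t := iota eta - j c; pose Q := \prod_(b <- s) ('X + (j c - b)%:P).
have tE : t = iota (eta - c%:A) by rewrite rmorphB.
have vt : vbar t = v (eta - c%:A) by rewrite tE hvbar.
have [] : gauss_lt vbar t Q.
  have -> : Q = 1%:P * \prod_(e <- [seq j c - b | b <- s]) ('X + e%:P) by rewrite mul1r big_map.
  apply: gauss_lt_prod => [|_ /mapP[b bs ->]]; first by rewrite Defs.val1.
  by rewrite addrA subrK vt cs.
move=> Qfin [Q0 Qlt].
have gQ : map_poly j (shift g c) = ('X - t%:P) * Q.
  rewrite map_comp_poly rmorphD /= map_polyX map_polyC gs comp_polyM rmorph_prod /=.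
  congr (_ * _); first by rewrite comp_polyB comp_polyX comp_polyC -addrA -polyCB -polyCN opprB.
  by apply: eq_bigr => b _; rewrite comp_polyB comp_polyX comp_polyC -addrA -polyCB.
(* Coefficient i + 1 of (X - t) Q is Q_i - t Q_(i+1). For i = 0 the term Q_0 wins; for larger i both
   terms contribute strictly larger values. *)
have TE i : T i.+1 = vbar ((Q`_i * t ^+ i) * t - (Q`_i.+1 * t ^+ i.+1) * t).
  rewrite /T -hvbar rmorphM rmorphXn -tE -[iota _%:A]/(j _) -coef_map gQ.
  by rewrite mulrBl coefB coefXM coefCM /=; congr (vbar _); rewrite exprS; ring.
have T1 : T 1%N = vadd (vbar Q.[t]) (vbar t).
  rewrite TE val_addl; first by rewrite mulr1 Defs.valM Q0.
  rewrite rvalN mulr1 [vbar (Q`_0 * t)]Defs.valM [X in vlt _ X]Defs.valM.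
  by apply: vltD2r; rewrite ?vt // Q0; exact: (Qlt 0%N).
rewrite T1; split=> [|i]; first by rewrite vadd_fin Qfin vt fin.
rewrite TE.
by apply: val_gtB; rewrite [vbar (_ * t)]Defs.valM; apply: vltD2r; rewrite ?vt.
Qed.

Theorem immediate_generators (hens : henselization vbar j (iota eta)) :
  (forall c, exists c' : K, vlt (v (eta - c%:A)) (v (eta - c'%:A))) ->
  exists c d : K, [/\ d != 0, (eta - c%:A) / d%:A \in valring v &
    [set` valring v] = localize v (adjoin (base_valring v) [set (eta - c%:A) / d%:A])].
Proof.
move=> nomax.
have fin (c : K) : v (eta - c%:A) != None by have [c' /vlt_fin] := nomax c.
have [g [s [c [g0 gs cs]]]] := separated_conjugates hens.
have [T1 T2] := linear_term_dominates gs cs (fin c).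
(* The value of eta - c is attained by some d in K, which makes theta a unit. *)
have [|d vd] := immediate_value (z := eta - c%:A); first by rewrite -(val_infty v).
have d0 : d%:A != 0 :> L by rewrite -(val_infty v) vd.
exists c, d; set th := _ / _.
have vth : v th = Some 0.
  by apply: (@vaddI _ _ _ (v d%:A)); rewrite ?vd // -{1}vd -Defs.valM divfK // vadd0.
have thO : th \in valring v by rewrite valringE vth vle_refl.
split=> //; first by rewrite -(scale_eq0 L).
set A := adjoin (base_valring v) [set th].
have AO : A `<=` [set` valring v] by apply: adjoin_valring => _ ->.
have A_th : A th by exact: adjoin_gen.
have A_base e : vle (Some 0) (v e%:A) -> A e%:A by move=> e0; apply: adjoin_base; exists e.
apply/seteqP; split; last exact: localize_valring.
(* The coefficients of H, normalized so that the linear one is 1. *)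
pose h i := (shift g c)`_i * d ^+ i / ((shift g c)`_1 * d).
have valT i : v (((shift g c)`_i)%:A * (eta - c%:A) ^+ i) = v ((shift g c)`_i * d ^+ i)%:A.
  by rewrite scaleME scaleXE !Defs.valM; congr vadd; elim: i => // i IH; rewrite !exprS !Defs.valM IH vd.
have k0 : (shift g c)`_1 * d != 0.
  by rewrite -(scale_eq0 L) -(val_infty v) -[d]expr1 -valT.
have h1 : h 1%N = 1 by rewrite /h expr1 mulfV.
have h2 i : vlt (Some 0) (v (h i.+2)%:A).
  apply: (@vltD2rE _ _ _ (v ((shift g c)`_1 * d ^+ 1)%:A)).
  rewrite vadd0 -Defs.valM -scaleME {2}expr1 divfK // -!valT; exact: T2.
have hth : \sum_(i < size (shift g c)) (h i)%:A * th ^+ i = 0.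
  have := taylor_shift (in_alg L) g c eta; rewrite g0 => /esym E0.
  apply: (mulfI (x := ((shift g c)`_1 * d)%:A)); first by rewrite scale_eq0.
  rewrite mulr0 -[RHS]E0 mulr_sumr; apply: eq_bigr => i _.
  rewrite mulrA -scaleME [_ * h i]mulrC /h divfK // scaleME scaleXE -mulrA; congr (_ * _).
  by rewrite -exprMn mulrC divfK.
move=> z /= zO; have [->|z0] := eqVneq z 0.
  by apply: sub_localize; [exact: adjoin1|exact: adjoin0].
have [c' [f [le ap zf]]] := immediate_approx z0 c.
(* This is c' in the coordinate of theta: theta - c2 = (eta - c') / d. It lies in O_K because c' is
   at least as close to eta as c. *)
pose c2 := (c' - c) / d.
have c2O : vle (Some 0) (v c2%:A).
  apply: (@vleD2rE _ _ _ (v d%:A)); first by rewrite vd.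
  rewrite vadd0 -Defs.valM -scaleME divfK -?(scale_eq0 L) // scalerBl.
  have -> : c'%:A - c%:A = (eta - c%:A) - (eta - c'%:A) by ring.
  by rewrite vd; apply: val_geB; rewrite ?vle_refl.
(* B = (H(theta) - H(c2)) / (theta - c2), so that (theta - c2) B = - H(c2) *)
pose D i := \sum_(k < i) th ^+ (i.-1 - k) * c2%:A ^+ k.
pose B := \sum_(i < size (shift g c)) (h i)%:A * D i.
pose H2 := \sum_(i < size (shift g c)) h i * c2 ^+ i.
have H2E : H2%:A = \sum_(i < size (shift g c)) (h i)%:A * c2%:A ^+ i :> L.
  transitivity (in_alg L H2) => //; rewrite rmorph_sum.
  by apply: eq_bigr => i _; rewrite /= scaleME scaleXE.
have thB : (eta - c'%:A) * B = (- (d * H2))%:A.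
  have -> : eta - c'%:A = d%:A * (th - c2%:A).
    rewrite mulrBr mulrC divfK // -scaleME mulrC divfK -?(scale_eq0 L) // scalerBl.
    by ring.
  rewrite scaleNr (scaleME L d H2) -mulrA -[RHS]mulrN; congr (_ * _).
  rewrite -[RHS]add0r -hth H2E -sumrB mulr_sumr.
  by apply: eq_bigr => i _; rewrite -mulrBr subrXX mulrCA.
have DO i : vle (Some 0) (v (D i)).
  apply: val_ge_sum => k _; apply: val_ge0M; last exact: val_ge0X.
  by rewrite (val_unitX _ vth) vle_refl.
have AD i : A (D i).
  apply: adjoin_sum => k _; apply: adjoinM; first exact: adjoinX.
  by rewrite -scaleXE; apply: A_base; rewrite scaleXE; exact: val_ge0X.
have D0 : D 0%N = 0 by rewrite /D big_ord0.
have AB : A B.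
  apply: adjoin_sum => -[[|[|i]] /= _] _.
  - by rewrite D0 mulr0; exact: adjoin0.
  - by rewrite h1 scale1r mul1r; exact: AD.
  - by apply: adjoinM (AD _); apply: A_base; exact: vltW (h2 i).
have sg1 : (1 < size (shift g c))%N.
  by rewrite ltnNge; apply: contra k0 => sg; rewrite nth_default ?mul0r.
(* In B the summand of index 0 vanishes, that of index 1 is 1, and all others lie in the maximal
   ideal. *)
have vB : v B = Some 0.
  rewrite /B (bigD1 (Ordinal sg1)) //= h1 scale1r mul1r.
  have -> : D 1%N = 1 by rewrite /D big_ord1 !expr0 mulr1.
  rewrite val_addl Defs.val1 //; apply: val_gt_sum => // -[[|[|i]] /= lt_i] // _.
    by rewrite D0 mulr0 val0.
  exact: val_gt0M (h2 i) (DO _).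
have B0 : B != 0 by rewrite -(val_infty v) vB.
pose N := size (shift f c').
(* Each factor eta - c' absorbs one B and becomes - d H2 in K. As B is a unit, the resulting
   coefficient in K has the value of the Taylor term, which is nonnegative. *)
have term i : (i <= N)%N -> A (((shift f c')`_i)%:A * (eta - c'%:A) ^+ i * B ^+ N).
  move=> iN; have -> : ((shift f c')`_i)%:A * (eta - c'%:A) ^+ i * B ^+ N =
      ((shift f c')`_i * (- (d * H2)) ^+ i)%:A * B ^+ (N - i).
    by rewrite scaleME scaleXE -thB exprMn -{1}(subnKC iN) exprD -!mulrA.
  apply: adjoinM; last exact: adjoinX.
  apply: A_base; have -> : v ((shift f c')`_i * (- (d * H2)) ^+ i)%:A =
      v (((shift f c')`_i)%:A * (eta - c'%:A) ^+ i).
    rewrite scaleME scaleXE -thB exprMn mulrA [LHS]Defs.valM (val_unitX _ vB).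
    by rewrite vaddC vadd0.
  have z_ge0 : vle (Some 0) (v (evL f)) by rewrite -zf.
  case: ap => _ f_0 f_lt; case: i {iN} => [|i]; first by rewrite mulr1 f_0.
  by apply: vltW; exact: vle_lt_trans z_ge0 (f_lt i).
exists (z * B ^+ N), (B ^+ N); split.
- rewrite {1}zf (taylor_shift (in_alg L) f c' eta) mulr_suml; apply: adjoin_sum => i _.
  by apply: term; exact: ltnW.
- exact: adjoinX.
- by rewrite not_maxideal (val_unitX _ vB) vle_refl.
- by rewrite mulfK // expf_neq0.
Qed.

End ImmediateCase.

(** * Combination of the cases *)

Lemma generator_shift (K : fieldType) (L : fieldExtType K) (eta : L) (c : K) :
  is_generator eta -> is_generator (eta - c%:A).
Proof.
move=> gen; apply/eqP; rewrite eqEsubv subvf -gen /=; apply/FadjoinP; split.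
  exact: subv_adjoin.
have : eta - c%:A + c%:A \in <<1; eta - c%:A>>%VS; last by rewrite subrK.
rewrite rpredD ?memv_adjoin //; apply: (subvP (subv_adjoin 1 _)).
by apply: memvZ; exact: mem1v.
Qed.

(** Division by 0 gives 0 in [rat], so defect 1 excludes the value 0 that stands for an infinite
    index or degree. *)
Lemma defect1 (G : oagType) (K : fieldType) (L : fieldExtType K) (v : valuation G L)
    (C : closedFieldType) (iota : {rmorphism L -> C}) (vbar : valuation G C) :
  defect iota v vbar = 1 ->
  ramification_index v != 0%N /\
  degree (henselization vbar (base_embed iota)) (henselization vbar iota) =
  (ramification_index v * residue_degree v)%N.
Proof.
rewrite /defect; set D := degree _ _; set ef := (_ * _)%N => D1.
have [E|ef0] := eqVneq ef 0%N.
  by move/eqP: D1; rewrite E invr0 mulr0 eq_sym oner_eq0.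
have efR : ef%:R != 0 :> rat by rewrite Num.Theory.pnatr_eq0.
have DE : D%:R = ef%:R :> rat by rewrite -[LHS](divfK efR) D1 mul1r.
split; last by apply/eqP; rewrite -(Num.Theory.eqr_nat rat) DE.
by apply: contra_neq ef0; rewrite /ef => ->.
Qed.

Theorem proposition1p3
  (G : oagType) (K : fieldType) (L : fieldExtType K) (v : valuation G L)
  (C : closedFieldType) (iota : {rmorphism L -> C}) (vbar : valuation G C)
  (hC : is_alg_closure iota)
  (hvbar : forall x : L, vbar (iota x) = v x)
  (hpure : pure iota v)
  (he : ramification_index v = ext_initial_index v)
  (hd : defect iota v vbar = 1) :
  let e := ramification_index v in
  exists (eta : L) (a : nat -> K),
    [/\ is_generator eta,
        forall l, (1 <= l <= e)%N -> a l != 0 /\ eta ^+ l / (a l)%:A \in valring v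
      & [set` valring v] =
        localize v (adjoin (base_valring v)
                      [set eta ^+ l / (a l)%:A | l in [set l | (1 <= l <= e)%N]])].
Proof.
move=> e; have [e0 degE] := defect1 hd.
have [eta gen [nubar ext no_key]] := hpure.
have dominated := roots_dominated ext no_key.
(* If eta lies in K, then L = K and 1 is a generator, nonzero even when eta is 0. *)
have [[c0 etac0]|eta_nK] := pselect (exists c : K, eta = c%:A).
  have [|z zO|a [a1 a2]] := @monomial_generators _ _ _ v 1 _ e0 he.
  - by rewrite Defs.val1.
  - have [f _ fz] := generator_poly gen z.
    have {fz}zc : z = (f.[c0])%:A by rewrite -fz etac0 -[c0%:A]/(in_alg L c0) horner_map.
    exists (f.[c0])%:P; split=> [|i].
      rewrite size_polyC; case: eqVneq => [E|_]; first by rewrite big_ord0 zc E scale0r.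
      by rewrite big_ord1 coefC expr0 mulr1.
    rewrite coefC expr1n mulr1; case: eqP => _; first by rewrite -zc.
    by rewrite scale0r val0.
  exists 1, a; split=> //.
  have eta1 : eta \in 1%VS by rewrite etac0 memvZ ?mem1v.
  by rewrite /is_generator -gen (Fadjoin_idP eta1); apply/Fadjoin_idP/mem1v.
have fin c : v (eta - c%:A) != None.
  by rewrite (val_infty v) subr_eq0; apply/eqP => E; apply: eta_nK; exists c.
have [[c0 c0max]|nomax] := pselect (exists c0 : K, forall c : K, vle (v (eta - c%:A)) (v (eta - c0%:A))).
  have [z zO|a [a1 a2]] := @monomial_generators _ _ _ v (eta - c0%:A) (fin c0) e0 he.
    have [f sf fz] := generator_poly gen z; exists (f \Po ('X + c0%:P)).
    split=> [|i]; first by rewrite -fz (taylor_shift (in_alg L) f c0 eta).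
    have [->|f0] := eqVneq f 0; first by rewrite comp_poly0 coef0 scale0r mul0r val0.
    have [c cdom] := dominated f sf f0.
    apply: (@vle_trans _ (v z)) => //; rewrite -fz; apply: (shift_val_le ext) => b fb.
    exact: vle_trans (cdom b fb) (c0max c).
  by exists (eta - c0%:A), a; split=> //; exact: generator_shift.
have {}nomax c : exists c' : K, vlt (v (eta - c%:A)) (v (eta - c'%:A)).
  apply: contrapT => none; apply: nomax; exists c => c'.
  by apply: contraT => lt; case: none; exists c'.
have approx (f : {poly K}) : f != 0 -> (size f <= \dim {:L})%N ->
    forall c1, exists c, vle (v (eta - c1%:A)) (v (eta - c%:A)) /\ approximates v eta f c.
  move=> f0 sf c1; have [c cdom] := dominated f sf f0.
  (* The better of c and [c1] is taken; a strictly better [c3] then gives the strict domination that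
     [shift_val_lt] requires. *)
  have [c2 [cc2 c1c2]] : exists c2 : K, vle (v (eta - c%:A)) (v (eta - c2%:A)) /\
      vle (v (eta - c1%:A)) (v (eta - c2%:A)).
    have [le|le] := orP (vle_total (v (eta - c%:A)) (v (eta - c1%:A))).
      by exists c1; rewrite vle_refl.
    by exists c; rewrite vle_refl.
  have [c3 c3lt] := nomax c2; exists c3; split; first exact: vle_trans c1c2 (vltW c3lt).
  apply: (shift_val_lt ext f0) => b fb.
  by apply: vle_lt_trans c3lt; exact: vle_trans (cdom b fb) cc2.
have e1 : e = 1%N by apply: ramification_index1 => z; exact: (immediate_value gen approx).
have f1 : residue_degree v = 1%N.
  by apply: residue_degree1 => z; exact: (immediate_residue gen approx).
have hens : henselization vbar (base_embed iota) (iota eta).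
  by apply: henselization_degree1; rewrite degE -/e e1 f1.
have [c [d [d0 thO OE]]] := immediate_generators hC hvbar gen approx hens nomax.
(* Since e = 1, only l = 1 occurs and a constant sequence suffices. *)
exists (eta - c%:A), (fun=> d); split; first exact: generator_shift.
  by move=> l; rewrite e1 -eqn_leq => /eqP <-; rewrite expr1.
rewrite OE; congr (localize _ (adjoin _ _)); apply/seteqP; split=> [_ ->|_ [l /= + <-]].
  by exists 1%N; rewrite ?expr1 //= e1.
by rewrite e1 -eqn_leq => /eqP <-; rewrite expr1.
Qed.
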